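(* Let $A,B$ be rings, $(\mathfrak{C},\Delta_{\mathfrak{C}},\varepsilon_{\mathfrak{C}})$ an $A$-coring and $(\mathfrak{D},\Delta_{\mathfrak{D}},\varepsilon_{\mathfrak{D}})$ a $B$-coring, and let $\Gamma=((M,\mathfrak{m}),(N,\mathfrak{n}),\eta,\rho)$ be a $1$-cell from $(\mathfrak{D}:B)$ to $(\mathfrak{C}:A)$ in the bicategory $\mathsf{W(REM(Bim))}$. Let $\mathcal{M}:\mathscr{M}^{\mathfrak{C}}\to\mathscr{M}^{\mathfrak{D}}$ and $\mathcal{N}:\mathscr{M}^{\mathfrak{D}}\to\mathscr{M}^{\mathfrak{C}}$ be the associated push-out functors, given on objects by $$\mathcal{M}(X,\varrho^X)=\big(X\otimes_AM,\ (X\otimes_A\mathfrak{m})\circ(\varrho^X\otimes_AM)\big),\qquad \mathcal{N}(Y,\varrho^Y)=\big(Y\otimes_BN,\ (Y\otimes_B\mathfrak{n})\circ(\varrho^Y\otimes_BN)\big)$$ and in the obvious way on morphisms. For a right $\mathfrak{C}$-comodule $(X,\varrho^X)$ and a right $\mathfrak{D}$-comodule $(Y,\varrho^Y)$ define the right linear maps $$\widetilde{\eta}_X=(X\otimes_A\eta)\circ(\varrho^X\otimes_AM\otimes_BN):X\otimes_AM\otimes_BN\to X\otimes_AA\cong X,$$ $$\widetilde{\rho}_Y=(Y\otimes_B\rho)\circ(\varrho^Y\otimes_BN\otimes_AM):Y\otimes_BN\otimes_AM\to Y\otimes_BB\cong Y,$$ where $X\otimes_AM\otimes_BN=\mathcal{N}\mathcal{M}(X)$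 and $Y\otimes_BN\otimes_AM=\mathcal{M}\mathcal{N}(Y)$ carry the comodule structures given by $\mathcal{N}\mathcal{M}$ and $\mathcal{M}\mathcal{N}$. Then: (i) $\widetilde{\eta}_X$ is right $\mathfrak{C}$-colinear and $\widetilde{\rho}_Y$ is right $\mathfrak{D}$-colinear. (ii) They define natural transformations $\widetilde{\eta}_{-}:\mathcal{N}\mathcal{M}\to\mathrm{id}_{\mathscr{M}^{\mathfrak{C}}}$ and $\widetilde{\rho}_{-}:\mathcal{M}\mathcal{N}\to\mathrm{id}_{\mathscr{M}^{\mathfrak{D}}}$ satisfying $$\widetilde{\eta}_{\mathcal{N}(Y)}=\mathcal{N}\widetilde{\rho}_Y\ \text{ for every }(Y,\varrho^Y)\in\mathscr{M}^{\mathfrak{D}},\qquad \widetilde{\rho}_{\mathcal{M}(X)}=\mathcal{M}\widetilde{\eta}_X\ \text{ for every }(X,\varrho^X)\in\mathscr{M}^{\mathfrak{C}}.$$ That is, $(\mathcal{N},\mathcal{M},\widetilde{\eta},\widetilde{\rho})$ is a wide right Morita context of functors between the categories $\mathscr{M}^{\mathfrak{C}}$ and $\mathscr{M}^{\mathfrak{D}}$.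
   Context: Rings are associative with $1$; modules and bimodules are unital; the identity map of a module $X$ is denoted $X$. Corings and comodules. An $A$-coring is $(\mathfrak{C},\Delta,\varepsilon)$ with $\mathfrak{C}$ an $A$-bimodule and $A$-bilinear maps $\Delta:\mathfrak{C}\to\mathfrak{C}\otimes_A\mathfrak{C}$, $\varepsilon:\mathfrak{C}\to A$ with $(\mathfrak{C}\otimes_A\Delta)\circ\Delta=(\Delta\otimes_A\mathfrak{C})\circ\Delta$ and $(\mathfrak{C}\otimes_A\varepsilon)\circ\Delta=\mathfrak{C}=(\varepsilon\otimes_A\mathfrak{C})\circ\Delta$. A right $\mathfrak{C}$-comodule is $(X,\varrho^X)$ with $X$ a right $A$-module and $\varrho^X:X\to X\otimes_A\mathfrak{C}$ right $A$-linear with $(\varrho^X\otimes_A\mathfrak{C})\circ\varrho^X=(X\otimes_A\Delta)\circ\varrho^X$ and $(X\otimes_A\varepsilon)\circ\varrho^X=X$. A right $A$-linear map $f:X\to X'$ is right $\mathfrak{C}$-colinear if $\varrho^{X'}\circ f=(f\otimes_A\mathfrak{C})\circ\varrho^X$. $\mathscr{M}^{\mathfrak{C}}$ is the category of right $\mathfrak{C}$-comodules and colinear maps. $1$-cells of $\mathsf{W(REM(Bim))}$. A $1$-cell from $(\mathfrak{D}:B)$ to $(\mathfrak{C}:A)$ is a four-tuple $((M,\mathfrak{m}),(N,\mathfrak{n}),\eta,\rho)$ where $M$ is an $(A,B)$-bimodule, $N$ is a $(B,A)$-bimodule, and $\mathfrak{m}:\mathfrak{C}\otimes_AM\to M\otimes_B\mathfrak{D}$,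 $\mathfrak{n}:\mathfrak{D}\otimes_BN\to N\otimes_A\mathfrak{C}$, $\eta:\mathfrak{C}\otimes_AM\otimes_BN\to A$, $\rho:\mathfrak{D}\otimes_BN\otimes_AM\to B$ are bilinear maps satisfying, up to the canonical isomorphisms $A\otimes_A-\cong-$, $-\otimes_AA\cong-$ (and likewise for $B$): $$(M\otimes_B\varepsilon_{\mathfrak{D}})\circ\mathfrak{m}=\varepsilon_{\mathfrak{C}}\otimes_AM,\quad(\mathfrak{m}\otimes_B\mathfrak{D})\circ(\mathfrak{C}\otimes_A\mathfrak{m})\circ(\Delta_{\mathfrak{C}}\otimes_AM)=(M\otimes_B\Delta_{\mathfrak{D}})\circ\mathfrak{m},$$ $$(N\otimes_A\varepsilon_{\mathfrak{C}})\circ\mathfrak{n}=\varepsilon_{\mathfrak{D}}\otimes_BN,\quad(\mathfrak{n}\otimes_A\mathfrak{C})\circ(\mathfrak{D}\otimes_B\mathfrak{n})\circ(\Delta_{\mathfrak{D}}\otimes_BN)=(N\otimes_A\Delta_{\mathfrak{C}})\circ\mathfrak{n},$$ $$(\eta\otimes_A\mathfrak{C})\circ(\mathfrak{C}\otimes_AM\otimes_B\mathfrak{n})\circ(\mathfrak{C}\otimes_A\mathfrak{m}\otimes_BN)\circ(\Delta_{\mathfrak{C}}\otimes_AM\otimes_BN)=(\mathfrak{C}\otimes_A\eta)\circ(\Delta_{\mathfrak{C}}\otimes_AM\otimes_BN),$$ $$(\rho\otimes_B\mathfrak{D})\circ(\mathfrak{D}\otimes_BN\otimes_A\mathfrak{m})\circ(\mathfrak{D}\otimes_B\mathfrak{n}\otimes_AM)\circ(\Delta_{\mathfrak{D}}\otimes_BN\otimes_AM)=(\mathfrak{D}\otimes_B\rho)\circ(\Delta_{\mathfrak{D}}\otimes_BN\otimes_AM),$$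 $$\eta\otimes_AM=(M\otimes_B\rho)\circ(\mathfrak{m}\otimes_BN\otimes_AM),\qquad\rho\otimes_BN=(N\otimes_A\eta)\circ(\mathfrak{n}\otimes_AM\otimes_BN).$$ Wide right Morita context of functors. Let $\mathcal{A},\mathcal{B}$ be additive categories with cokernels and direct sums. A wide right Morita context between $\mathcal{A}$ and $\mathcal{B}$ is $(\mathcal{F},\mathcal{G},\eta,\rho)$ with $\mathcal{F}:\mathcal{B}\to\mathcal{A}$, $\mathcal{G}:\mathcal{A}\to\mathcal{B}$ additive covariant functors preserving cokernels, and natural transformations $\eta:\mathcal{F}\mathcal{G}\to\mathrm{id}_{\mathcal{A}}$, $\rho:\mathcal{G}\mathcal{F}\to\mathrm{id}_{\mathcal{B}}$ with $\eta_{\mathcal{F}(Y)}=\mathcal{F}\rho_Y$ and $\rho_{\mathcal{G}(X)}=\mathcal{G}\eta_X$ for all $Y\in\mathcal{B}$, $X\in\mathcal{A}$. (The category $\mathscr{M}^{\mathfrak{C}}$ has cokernels and direct sums, computed in right $A$-modules.) *)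

(* Defs.v *)
From HB Require Import structures.
From mathcomp Require Import all_boot all_algebra.
From mathcomp Require Import boolp.
From mathcomp.multinomials Require Import freeg.

Set Implicit Arguments.
Unset Strict Implicit.
Unset Printing Implicit Defensive.

Import GRing.Theory.

Local Open Scope ring_scope.
Local Open Scope quotient_scope.

Reserved Notation "{ 'rlinear' U -> V }"
  (at level 0, U at level 98, V at level 99, format "{ 'rlinear'  U  ->  V }").
Reserved Notation "{ 'bihom' U -> V }"
  (at level 0, U at level 98, V at level 99, format "{ 'bihom'  U  ->  V }").
Reserved Notation "X ⊗ Y" (at level 40, left associativity).
Reserved Notation "f <⊗> g" (at level 40, left associativity).
Reserved Notation "g ∘ f" (at level 40, left associativity).
Reserved Notation "''id[' X ]" (at level 0, format "''id[' X ]").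

(* Rings are [pzRingType]s, so the zero ring is allowed; left modules are      *)
(* [lmodType]s, and [isBimodule] is the compatibility of a left and a right    *)
(* action on the same abelian group.                                           *)

HB.mixin Record Zmodule_isRmodule (A : pzRingType) V of GRing.Zmodule V := {
  ract : V -> A -> V;
  ractA : forall v a b, ract (ract v a) b = ract v (a * b);
  ractr1 : forall v, ract v 1 = v;
  ractDl : forall a, {morph ract^~ a : u v / u + v};
  ractDr : forall v, {morph ract v : a b / a + b}
}.

#[short(type="rmodType")]
HB.structure Definition Rmodule (A : pzRingType) :=
  {V of GRing.Zmodule V & Zmodule_isRmodule A V}.

Notation "v :* a" := (ract v a) : ring_scope.

HB.mixin Record isBimodule (A B : pzRingType) V
    of GRing.Lmodule A V & Rmodule B V := {
  scale_ract : forall (a : A) (v : V) (b : B), (a *: v) :* b = a *: (v :* b)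
}.

#[short(type="bimodType")]
HB.structure Definition Bimodule (A B : pzRingType) :=
  {V of isBimodule A B V & GRing.Lmodule A V & Rmodule B V}.

HB.mixin Record isRscalable (A : pzRingType) (U V : rmodType A) (f : U -> V) := {
  rscalable_subproof : forall a, {morph f : u / u :* a}
}.

#[short(type="rlinearType")]
HB.structure Definition Rlinear (A : pzRingType) (U V : rmodType A) :=
  {f of @GRing.Additive U V f & isRscalable A U V f}.

Notation "{ 'rlinear' U -> V }" := (Rlinear.type U%type V%type) : type_scope.

HB.structure Definition Bihom (A B : pzRingType) (U V : bimodType A B) :=
  {f of @GRing.Linear A U V *:%R f & @Rlinear B U V f}.

Notation "{ 'bihom' U -> V }" := (Bihom.type U%type V%type) : type_scope.

Lemma rlinearZ (A : pzRingType) (U V : rmodType A) (f : {rlinear U -> V}) u a :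
  f (u :* a) = f u :* a.
Proof. exact: rscalable_subproof. Qed.

Section RlinearTheory.
Variables (A : pzRingType) (U V W : rmodType A).

Fact idfun_rscalable a : {morph @idfun U : u / u :* a}.
Proof. by []. Qed.
HB.instance Definition _ := isRscalable.Build A U U idfun idfun_rscalable.

Fact comp_rscalable (f : {rlinear V -> W}) (g : {rlinear U -> V}) a :
  {morph f \o g : u / u :* a}.
Proof. by move=> u /=; rewrite !rlinearZ. Qed.
HB.instance Definition _ (f : {rlinear V -> W}) (g : {rlinear U -> V}) :=
  isRscalable.Build A U W (f \o g) (comp_rscalable f g).
End RlinearTheory.

HB.instance Definition _ (A B : pzRingType) (U : bimodType A B) :=
  Rlinear.on (@idfun U).
HB.instance Definition _ (A B : pzRingType) (U V W : bimodType A B)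
  (f : {bihom V -> W}) (g : {bihom U -> V}) := Rlinear.on (f \o g).

Section Regular.
Variable A : pzRingType.
Fact regular_ractA (v : A^o) (a b : A) : (v * a) * b = v * (a * b) :> A^o.
Proof. by rewrite mulrA. Qed.
Fact regular_ractr1 (v : A^o) : v * 1 = v :> A^o.
Proof. by rewrite mulr1. Qed.
Fact regular_ractDl (a : A) : {morph (fun v : A^o => v * a : A^o) : u v / u + v}.
Proof. by move=> u v; rewrite mulrDl. Qed.
Fact regular_ractDr (v : A^o) : {morph (fun a : A => v * a : A^o) : a b / a + b}.
Proof. by move=> a b; rewrite mulrDr. Qed.
HB.instance Definition _ := Zmodule_isRmodule.Build A A^o
  regular_ractA regular_ractr1 regular_ractDl regular_ractDr.
Fact regular_scale_ract (a : A) (v : A^o) (b : A) : (a *: v) :* b = a *: (v :* b).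
Proof. exact: (regular_ractA a v b). Qed.
HB.instance Definition _ := isBimodule.Build A A A^o regular_scale_ract.
End Regular.

(* [X ⊗ M] is the free abelian group on [X * M] modulo the subgroup generated  *)
(* by the biadditivity and [A]-balancedness relations.                         *)
Section Tensor.
Variables (A : pzRingType) (X : rmodType A) (M : lmodType A).

Inductive tensor_rel : {freeg (X * M) / int} -> Prop :=
| tensor_rel0 : tensor_rel 0
| tensor_relB u v : tensor_rel u -> tensor_rel v -> tensor_rel (u - v)
| tensor_rel_Dl x y m :
    tensor_rel (<< (x + y, m) >> - << (x, m) >> - << (y, m) >>)
| tensor_rel_Dr x m n :
    tensor_rel (<< (x, m + n) >> - << (x, m) >> - << (x, n) >>)
| tensor_rel_bal x a m : tensor_rel (<< (x :* a, m) >> - << (x, a *: m) >>).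

Definition tensor_ideal : {pred {freeg (X * M) / int}} :=
  fun u => `[< tensor_rel u >].

Fact tensor_ideal_zmod_closed : zmod_closed tensor_ideal.
Proof.
split=> [|u v /asboolP ru /asboolP rv]; apply/asboolP; first exact: tensor_rel0.
exact: tensor_relB.
Qed.

HB.instance Definition _ :=
  GRing.isZmodClosed.Build _ tensor_ideal tensor_ideal_zmod_closed.

Definition tensor : Type := Quotient.quot tensor_ideal.
HB.instance Definition _ := GRing.Zmodule.on tensor.

Definition pure (x : X) (m : M) : tensor := \pi_tensor << (x, m) >>.
End Tensor.

Notation "X ⊗ M" := (tensor X%type M%type) : type_scope.
Notation "x ⊗ m" := (pure x m) : ring_scope.

Section TensorLift.
Variables (A : pzRingType) (X : rmodType A) (M : lmodType A) (G : zmodType).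

Record balanced (h : X -> M -> G) : Prop := Balanced {
  balancedDl : forall x y m, h (x + y) m = h x m + h y m;
  balancedDr : forall x m n, h x (m + n) = h x m + h x n;
  balancedA : forall x a m, h (x :* a) m = h x (a *: m)
}.

Definition freeg_sum (h : X -> M -> G) (u : {freeg (X * M) / int}) : G :=
  \sum_(p <- dom u) h p.1 p.2 *~ coeff p u.

(* The additive map [x ⊗ m |-> h x m]; meaningful for balanced [h] only.       *)
Definition tensor_lift (h : X -> M -> G) (t : X ⊗ M) : G := freeg_sum h (repr t).

Let fgl (h : X -> M -> G) : {freeg (X * M) / int} -> zmodule G :=
  fglift (fun p : X * M => h p.1 p.2 : zmodule G).

Lemma freeg_sumE h u : freeg_sum h u = fgl h u.
Proof.
have fglB := lift_is_additive (fun p : X * M => h p.1 p.2 : zmodule G).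
pose F : {additive _ -> _} := HB.pack (fgl h) (GRing.isZmodMorphism.Build _ _ _ fglB).
rewrite -[fgl h u]/(F u) -[in RHS](freeg.freeg_sumE u) (raddf_sum F).
by apply: eq_bigr => p _; rewrite /F /= /fgl liftU.
Qed.

Lemma freeg_sumB h u v : freeg_sum h (u - v) = freeg_sum h u - freeg_sum h v.
Proof. by rewrite !freeg_sumE /fgl lift_is_additive. Qed.

Lemma freeg_sumU h x m : freeg_sum h << (x, m) >> = h x m.
Proof. by rewrite freeg_sumE /fgl liftU scale1r. Qed.

Lemma freeg_sum_rel h u : balanced h -> tensor_rel u -> freeg_sum h u = 0.
Proof.
move=> hb; elim=> {u} [|u v _ hu _ hv|x y m|x m n|x a m].
- by rewrite -[0](subrr 0) freeg_sumB subrr.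
- by rewrite freeg_sumB hu hv subrr.
- by rewrite !freeg_sumB !freeg_sumU balancedDl // -addrA -opprD subrr.
- by rewrite !freeg_sumB !freeg_sumU balancedDr // -addrA -opprD subrr.
- by rewrite !freeg_sumB !freeg_sumU balancedA // subrr.
Qed.

Lemma tensor_lift_pi h u : balanced h ->
  tensor_lift h (\pi_(X ⊗ M) u) = freeg_sum h u.
Proof.
move=> hb; apply/eqP; rewrite -subr_eq0 -freeg_sumB; apply/eqP.
apply: freeg_sum_rel => //; apply/asboolP.
have := @Quotient.idealrBE _ (@tensor_ideal A X M) (repr (\pi_(X ⊗ M) u)) u.
by rewrite reprK eqxx.
Qed.

Lemma tensor_lift_pure h x m : balanced h -> tensor_lift h (x ⊗ m) = h x m.
Proof. by move=> hb; rewrite tensor_lift_pi // freeg_sumU. Qed.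

Lemma tensor_lift_zmod h : balanced h -> zmod_morphism (tensor_lift h).
Proof.
move=> hb s t; rewrite -[s]reprK -[t]reprK -raddfB.
by rewrite !tensor_lift_pi // freeg_sumB.
Qed.

Lemma tensor_liftD h : balanced h -> {morph tensor_lift h : s t / s + t}.
Proof.
move=> hb; pose F : {additive _ -> _} := HB.pack (tensor_lift h)
  (GRing.isZmodMorphism.Build _ _ _ (tensor_lift_zmod hb)).
exact: (raddfD F).
Qed.
End TensorLift.

Section TensorTheory.
Variables (A : pzRingType) (X : rmodType A) (M : lmodType A).

Lemma pure_pi_rel (u v : {freeg (X * M) / int}) :
  tensor_rel (u - v) -> \pi_(X ⊗ M) u = \pi_(X ⊗ M) v.
Proof.
by move=> r; apply/eqP; rewrite -(@Quotient.idealrBE _ (@tensor_ideal A X M)); apply/asboolP.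
Qed.

Lemma pureDl (x y : X) (m : M) : (x + y) ⊗ m = x ⊗ m + y ⊗ m.
Proof.
rewrite /pure -raddfD; apply: pure_pi_rel; rewrite opprD addrA.
exact: tensor_rel_Dl.
Qed.

Lemma pureDr (x : X) (m n : M) : x ⊗ (m + n) = x ⊗ m + x ⊗ n.
Proof.
rewrite /pure -raddfD; apply: pure_pi_rel; rewrite opprD addrA.
exact: tensor_rel_Dr.
Qed.

Lemma pureA (x : X) (a : A) (m : M) : (x :* a) ⊗ m = x ⊗ (a *: m).
Proof. by apply: pure_pi_rel; apply: tensor_rel_bal. Qed.

Lemma balanced_pure : balanced (@pure A X M).
Proof. by split; [exact: pureDl | exact: pureDr | exact: pureA]. Qed.

Lemma pureNl (x : X) (m : M) : (- x) ⊗ m = - (x ⊗ m).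
Proof. apply/eqP; rewrite -addr_eq0 -pureDl addNr. 
by rewrite -(addrK (0 ⊗ m) (0 ⊗ m)) -pureDl addr0 subrr.
Qed.

Lemma tensor_ind (P : X ⊗ M -> Prop) :
  (forall x m, P (x ⊗ m)) -> (forall s t, P s -> P t -> P (s + t)) ->
  forall t, P t.
Proof.
move=> Ppure PD t.
have P0 : P 0.
  by rewrite -(subrr (0 ⊗ 0)) -pureNl; apply: PD; apply: Ppure.
rewrite -[t]reprK -[repr t]freeg.freeg_sumE raddf_sum.
elim/big_ind: _ => // p _; case: p => x m.
set c := coeff _ _.
have -> : << c *g (x, m) >> = << (x, m) >> *~ c :> {freeg (X * M) / int}.
  by rewrite freegU_mulz intz.
rewrite raddfMz; have Ppos n : P ((x ⊗ m) *+ n).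
  by elim: n => [|n IHn]; rewrite ?mulr0n // mulrS; apply: PD.
have := Ppos; case: c => n Pp; first exact: Pp.
rewrite NegzE mulrNz -mulNrz -pureNl; elim: n.+1 => [//|k IHk].
by rewrite -pmulrn mulrS; apply: PD => //; exact: IHk.
Qed.

Lemma tensor_ext (G : zmodType) (f g : X ⊗ M -> G) :
  {morph f : s t / s + t} -> {morph g : s t / s + t} ->
  (forall x m, f (x ⊗ m) = g (x ⊗ m)) -> f =1 g.
Proof.
move=> fD gD fg; elim/tensor_ind => // s t fgs fgt.
by rewrite fD gD fgs fgt.
Qed.
End TensorTheory.

Section TensorLeft.
Variables (B A : pzRingType) (X : bimodType B A) (M : lmodType A).

Definition tensor_scale (b : B) : X ⊗ M -> X ⊗ M :=
  tensor_lift (fun x m => (b *: x) ⊗ m).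

Fact tensor_scale_balanced (b : B) :
  balanced (fun (x : X) (m : M) => (b *: x) ⊗ m).
Proof.
by split=> *; rewrite ?scalerDr ?pureDl ?pureDr // -scale_ract pureA.
Qed.

Fact tensor_scale_pure b x m : tensor_scale b (x ⊗ m) = (b *: x) ⊗ m.
Proof. exact/tensor_lift_pure/tensor_scale_balanced. Qed.

Fact tensor_scaleDr : right_distributive tensor_scale +%R.
Proof. by move=> b; apply/tensor_liftD/tensor_scale_balanced. Qed.

Fact tensor_scaleA a b t :
  tensor_scale a (tensor_scale b t) = tensor_scale (a * b) t.
Proof.
elim/tensor_ind: t => [x m|s t IHs IHt].
  by rewrite !tensor_scale_pure scalerA.
by rewrite !tensor_scaleDr IHs IHt.
Qed.

Fact tensor_scale1 : left_id 1 tensor_scale.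
Proof.
elim/tensor_ind => [x m|s t IHs IHt]; first by rewrite tensor_scale_pure scale1r.
by rewrite tensor_scaleDr IHs IHt.
Qed.

Fact tensor_scaleDl t : {morph tensor_scale^~ t : a b / a + b}.
Proof.
move=> a b; elim/tensor_ind: t => [x m|s t IHs IHt].
  by rewrite !tensor_scale_pure scalerDl pureDl.
by rewrite !tensor_scaleDr IHs IHt addrACA.
Qed.

HB.instance Definition _ := GRing.Zmodule_isLmodule.Build B (tensor X M)
  tensor_scaleA tensor_scale1 tensor_scaleDr tensor_scaleDl.

Lemma scale_pure (b : B) (x : X) (m : M) : b *: (x ⊗ m) = (b *: x) ⊗ m.
Proof. exact: tensor_scale_pure. Qed.
End TensorLeft.

Section TensorRight.
Variables (A B : pzRingType) (X : rmodType A) (M : bimodType A B).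

Definition tensor_ract (t : X ⊗ M) (b : B) : X ⊗ M :=
  tensor_lift (fun x m => x ⊗ (m :* b)) t.

Fact tensor_ract_balanced (b : B) :
  balanced (fun (x : X) (m : M) => x ⊗ (m :* b)).
Proof.
by split=> *; rewrite ?ractDl ?pureDl ?pureDr // scale_ract pureA.
Qed.

Fact tensor_ract_pure x m b : tensor_ract (x ⊗ m) b = x ⊗ (m :* b).
Proof. exact/tensor_lift_pure/tensor_ract_balanced. Qed.

Fact tensor_ractDl b : {morph tensor_ract^~ b : s t / s + t}.
Proof. exact/tensor_liftD/tensor_ract_balanced. Qed.

Fact tensor_ractA t a b :
  tensor_ract (tensor_ract t a) b = tensor_ract t (a * b).
Proof.
elim/tensor_ind: t => [x m|s t IHs IHt].
  by rewrite !tensor_ract_pure ractA.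
by rewrite !tensor_ractDl IHs IHt.
Qed.

Fact tensor_ractr1 t : tensor_ract t 1 = t.
Proof.
elim/tensor_ind: t => [x m|s t IHs IHt]; first by rewrite tensor_ract_pure ractr1.
by rewrite tensor_ractDl IHs IHt.
Qed.

Fact tensor_ractDr t : {morph tensor_ract t : a b / a + b}.
Proof.
move=> a b; elim/tensor_ind: t => [x m|s t IHs IHt].
  by rewrite !tensor_ract_pure ractDr pureDr.
by rewrite !tensor_ractDl IHs IHt addrACA.
Qed.

HB.instance Definition _ := Zmodule_isRmodule.Build B (tensor X M)
  tensor_ractA tensor_ractr1 tensor_ractDl tensor_ractDr.

Lemma ract_pure (x : X) (m : M) (b : B) : (x ⊗ m) :* b = x ⊗ (m :* b).
Proof. exact: tensor_ract_pure. Qed.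
End TensorRight.

Section TensorBimodule.
Variables (A B C : pzRingType) (X : bimodType A B) (M : bimodType B C).

Fact tensor_scale_ract (a : A) (t : X ⊗ M) (c : C) :
  (a *: t) :* c = a *: (t :* c).
Proof.
elim/tensor_ind: t => [x m|s t IHs IHt].
  by rewrite scale_pure !ract_pure scale_pure.
by rewrite scalerDr !ractDl IHs IHt scalerDr.
Qed.
HB.instance Definition _ := isBimodule.Build A C (tensor X M) tensor_scale_ract.
End TensorBimodule.

Section TensorMap.
Variables (A : pzRingType) (X X' : rmodType A) (M M' : lmodType A).
Variables (f : {rlinear X -> X'}) (g : {linear M -> M'}).

Definition tensor_map : X ⊗ M -> X' ⊗ M' :=
  tensor_lift (fun x m => f x ⊗ g m).

Fact tensor_map_balanced : balanced (fun (x : X) (m : M) => f x ⊗ g m).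
Proof.
by split=> *; rewrite ?raddfD ?pureDl ?pureDr // rlinearZ linearZ pureA.
Qed.

Lemma tensor_map_pure x m : tensor_map (x ⊗ m) = f x ⊗ g m.
Proof. exact/tensor_lift_pure/tensor_map_balanced. Qed.

HB.instance Definition _ := GRing.isZmodMorphism.Build (tensor X M) (tensor X' M')
  tensor_map (tensor_lift_zmod tensor_map_balanced).
End TensorMap.

Notation "f <⊗> g" := (tensor_map f g) : ring_scope.

Section TensorMapLeft.
Variables (B A : pzRingType) (X X' : bimodType B A) (M M' : lmodType A).
Variables (f : {bihom X -> X'}) (g : {linear M -> M'}).

Fact tensor_map_scalable : scalable (tensor_map f g).
Proof.
move=> b; elim/tensor_ind=> [x m|s t IHs IHt].
  by rewrite scale_pure !tensor_map_pure /= linearZ scale_pure.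
by rewrite scalerDr !raddfD /= IHs IHt.
Qed.
HB.instance Definition _ := GRing.isScalable.Build B (tensor X M) (tensor X' M')
  *:%R (tensor_map f g) tensor_map_scalable.
End TensorMapLeft.

Section TensorMapRight.
Variables (A B : pzRingType) (X X' : rmodType A) (M M' : bimodType A B).
Variables (f : {rlinear X -> X'}) (g : {bihom M -> M'}).

Fact tensor_map_rscalable b : {morph tensor_map f g : t / t :* b}.
Proof.
elim/tensor_ind=> [x m|s t IHs IHt].
  by rewrite ract_pure !tensor_map_pure /= rlinearZ ract_pure.
by rewrite ractDl !raddfD /= IHs IHt ractDl.
Qed.
HB.instance Definition _ := isRscalable.Build B (tensor X M) (tensor X' M')
  (tensor_map f g) tensor_map_rscalable.
End TensorMapRight.

HB.instance Definition _ (A B C : pzRingType) (X X' : bimodType A B)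
    (M M' : bimodType B C) (f : {bihom X -> X'}) (g : {bihom M -> M'}) :=
  Rlinear.on (tensor_map f g).

(* The canonical isomorphisms (X ⊗ M) ⊗ N ≅ X ⊗ (M ⊗ N), X ⊗ A ≅ X, A ⊗ M ≅ M. *)
Section TensorAssoc.
Variables (A B : pzRingType).
Variables (X : rmodType A) (M : bimodType A B) (N : lmodType B).

Definition tensorA : (X ⊗ M) ⊗ N -> X ⊗ (M ⊗ N) :=
  tensor_lift (fun t n => tensor_lift (fun x m => x ⊗ (m ⊗ n)) t).

Definition tensorAV : X ⊗ (M ⊗ N) -> (X ⊗ M) ⊗ N :=
  tensor_lift (fun x t => tensor_lift (fun m n => (x ⊗ m) ⊗ n) t).

Fact tensorA_balanced1 (n : N) :
  balanced (fun (x : X) (m : M) => x ⊗ (m ⊗ n)).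
Proof.
by split=> *; rewrite ?pureDl ?pureDr // pureA scale_pure.
Qed.

Fact tensorAV_balanced1 (x : X) :
  balanced (fun (m : M) (n : N) => (x ⊗ m) ⊗ n).
Proof.
by split=> *; rewrite ?pureDr ?pureDl // -ract_pure pureA.
Qed.

Fact tensorA_balanced :
  balanced (fun (t : X ⊗ M) (n : N) => tensor_lift (fun x m => x ⊗ (m ⊗ n)) t).
Proof.
have b1 := tensorA_balanced1.
split=> [s t n|t n n'|t b n]; first exact/tensor_liftD/b1.
- elim/tensor_ind: t => [x m|s t IHs IHt].
    by rewrite !tensor_lift_pure // !pureDr.
  by rewrite !tensor_liftD // IHs IHt addrACA.
- elim/tensor_ind: t => [x m|s t IHs IHt].
    by rewrite ract_pure !tensor_lift_pure // pureA.
  by rewrite ractDl !tensor_liftD // IHs IHt.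
Qed.

Fact tensorAV_balanced :
  balanced (fun (x : X) (t : M ⊗ N) => tensor_lift (fun m n => (x ⊗ m) ⊗ n) t).
Proof.
have b1 := tensorAV_balanced1.
split=> [x y t|x s t|x a t]; last 2 first.
- exact/tensor_liftD/b1.
- elim/tensor_ind: t => [m n|s t IHs IHt].
    by rewrite scale_pure !tensor_lift_pure // pureA.
  by rewrite scalerDr !tensor_liftD // IHs IHt.
elim/tensor_ind: t => [m n|s t IHs IHt].
  by rewrite !tensor_lift_pure // !pureDl.
by rewrite !tensor_liftD // IHs IHt addrACA.
Qed.

Lemma tensorA_pure x m n : tensorA ((x ⊗ m) ⊗ n) = x ⊗ (m ⊗ n).
Proof.
rewrite /tensorA tensor_lift_pure; last exact: tensorA_balanced.
exact/tensor_lift_pure/tensorA_balanced1.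
Qed.

Lemma tensorAV_pure x m n : tensorAV (x ⊗ (m ⊗ n)) = (x ⊗ m) ⊗ n.
Proof.
rewrite /tensorAV tensor_lift_pure; last exact: tensorAV_balanced.
exact/tensor_lift_pure/tensorAV_balanced1.
Qed.

HB.instance Definition _ := GRing.isZmodMorphism.Build
  (tensor (tensor X M) N) (tensor X (tensor M N))
  tensorA (tensor_lift_zmod tensorA_balanced).
HB.instance Definition _ := GRing.isZmodMorphism.Build
  (tensor X (tensor M N)) (tensor (tensor X M) N)
  tensorAV (tensor_lift_zmod tensorAV_balanced).
End TensorAssoc.

Lemma tensor3_ind (A B : pzRingType) (X : rmodType A) (M : bimodType A B)
    (N : lmodType B) (P : (X ⊗ M) ⊗ N -> Prop) :
  (forall x m n, P ((x ⊗ m) ⊗ n)) -> (forall s t, P s -> P t -> P (s + t)) ->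
  forall t, P t.
Proof.
move=> Pp PD; elim/tensor_ind=> [t n|]; last exact: PD.
elim/tensor_ind: t => [x m|s t IHs IHt]; first exact: Pp.
by rewrite pureDl; exact: PD.
Qed.

Lemma tensor3V_ind (A B : pzRingType) (X : rmodType A) (M : bimodType A B)
    (N : lmodType B) (P : X ⊗ (M ⊗ N) -> Prop) :
  (forall x m n, P (x ⊗ (m ⊗ n))) -> (forall s t, P s -> P t -> P (s + t)) ->
  forall t, P t.
Proof.
move=> Pp PD; elim/tensor_ind=> [x t|]; last exact: PD.
elim/tensor_ind: t => [m n|s t IHs IHt]; first exact: Pp.
by rewrite pureDr; exact: PD.
Qed.

Section TensorAssocTheory.
Variables (A B : pzRingType).
Variables (X : rmodType A) (M : bimodType A B) (N : lmodType B).

Lemma tensorAK : cancel (@tensorA A B X M N) (@tensorAV A B X M N).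
Proof.
elim/tensor3_ind => [x m n|s t IHs IHt]; first by rewrite tensorA_pure tensorAV_pure.
by rewrite !raddfD /= IHs IHt.
Qed.

Lemma tensorAVK : cancel (@tensorAV A B X M N) (@tensorA A B X M N).
Proof.
elim/tensor3V_ind => [x m n|s t IHs IHt]; first by rewrite tensorAV_pure tensorA_pure.
by rewrite !raddfD /= IHs IHt.
Qed.
End TensorAssocTheory.

Section TensorAssocRight.
Variables (A B C : pzRingType).
Variables (X : rmodType A) (M : bimodType A B) (N : bimodType B C).

Fact tensorA_rscalable c : {morph @tensorA A B X M N : t / t :* c}.
Proof.
elim/tensor3_ind => [x m n|s t IHs IHt].
  by rewrite ract_pure !tensorA_pure !ract_pure.
by rewrite ractDl !raddfD /= IHs IHt ractDl.
Qed.
HB.instance Definition _ := isRscalable.Build C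
  (tensor (tensor X M) N) (tensor X (tensor M N))
  (@tensorA A B X M N) tensorA_rscalable.

Fact tensorAV_rscalable c : {morph @tensorAV A B X M N : t / t :* c}.
Proof.
elim/tensor3V_ind => [x m n|s t IHs IHt].
  by rewrite !ract_pure !tensorAV_pure !ract_pure.
by rewrite ractDl !raddfD /= IHs IHt ractDl.
Qed.
HB.instance Definition _ := isRscalable.Build C
  (tensor X (tensor M N)) (tensor (tensor X M) N)
  (@tensorAV A B X M N) tensorAV_rscalable.
End TensorAssocRight.

Section TensorAssocLeft.
Variables (A B C : pzRingType).
Variables (X : bimodType A B) (M : bimodType B C) (N : lmodType C).

Fact tensorA_scalable : scalable (@tensorA B C X M N).
Proof.
move=> a; elim/tensor3_ind => [x m n|s t IHs IHt].
  by rewrite !scale_pure !tensorA_pure scale_pure.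
by rewrite scalerDr !raddfD /= IHs IHt.
Qed.
HB.instance Definition _ := GRing.isScalable.Build A
  (tensor (tensor X M) N) (tensor X (tensor M N))
  *:%R (@tensorA B C X M N) tensorA_scalable.

Fact tensorAV_scalable : scalable (@tensorAV B C X M N).
Proof.
move=> a; elim/tensor3V_ind => [x m n|s t IHs IHt].
  by rewrite !scale_pure !tensorAV_pure !scale_pure.
by rewrite scalerDr !raddfD /= IHs IHt.
Qed.
HB.instance Definition _ := GRing.isScalable.Build A
  (tensor X (tensor M N)) (tensor (tensor X M) N)
  *:%R (@tensorAV B C X M N) tensorAV_scalable.
End TensorAssocLeft.

HB.instance Definition _ (A B C D : pzRingType) (X : bimodType A B)
    (M : bimodType B C) (N : bimodType C D) :=
  Rlinear.on (@tensorA B C X M N).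
HB.instance Definition _ (A B C D : pzRingType) (X : bimodType A B)
    (M : bimodType B C) (N : bimodType C D) :=
  Rlinear.on (@tensorAV B C X M N).

Section TensorUnitRight.
Variables (A : pzRingType) (X : rmodType A).

Definition tensorR1 : X ⊗ A^o -> X := tensor_lift (fun x (a : A^o) => x :* a).

Fact tensorR1_balanced : balanced (fun (x : X) (a : A^o) => x :* a).
Proof. by split=> *; rewrite ?ractDl ?ractDr // ractA. Qed.

Lemma tensorR1_pure (x : X) (a : A^o) : tensorR1 (x ⊗ a) = x :* a.
Proof. exact/tensor_lift_pure/tensorR1_balanced. Qed.

HB.instance Definition _ := GRing.isZmodMorphism.Build (tensor X A^o) X
  tensorR1 (tensor_lift_zmod tensorR1_balanced).

Fact tensorR1_rscalable a : {morph tensorR1 : t / t :* a}.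
Proof.
elim/tensor_ind=> [x b|s t IHs IHt].
  by rewrite ract_pure !tensorR1_pure ractA.
by rewrite ractDl !raddfD /= IHs IHt ractDl.
Qed.
HB.instance Definition _ := isRscalable.Build A (tensor X A^o) X
  tensorR1 tensorR1_rscalable.
End TensorUnitRight.

Section TensorUnitLeft.
Variables (A : pzRingType) (M : lmodType A).

Definition tensorL1 : A^o ⊗ M -> M := tensor_lift (fun (a : A^o) m => (a : A) *: m).

Fact tensorL1_balanced : balanced (fun (a : A^o) (m : M) => (a : A) *: m).
Proof. by split=> *; rewrite ?scalerDl ?scalerDr // scalerA. Qed.

Lemma tensorL1_pure (a : A^o) (m : M) : tensorL1 (a ⊗ m) = (a : A) *: m.
Proof. exact/tensor_lift_pure/tensorL1_balanced. Qed.

HB.instance Definition _ := GRing.isZmodMorphism.Build (tensor A^o M) M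
  tensorL1 (tensor_lift_zmod tensorL1_balanced).

Fact tensorL1_scalable : scalable tensorL1.
Proof.
move=> a; elim/tensor_ind=> [b m|s t IHs IHt].
  by rewrite scale_pure !tensorL1_pure scalerA.
by rewrite scalerDr !raddfD /= IHs IHt.
Qed.
HB.instance Definition _ := GRing.isScalable.Build A (tensor A^o M) M *:%R
  tensorL1 tensorL1_scalable.
End TensorUnitLeft.

Section TensorUnitBimodule.
Variables (A B : pzRingType).

Fact tensorR1_scalable (X : bimodType A B) : scalable (@tensorR1 B X).
Proof.
move=> a; elim/tensor_ind=> [x b|s t IHs IHt].
  by rewrite scale_pure !tensorR1_pure scale_ract.
by rewrite scalerDr !raddfD /= IHs IHt.
Qed.
HB.instance Definition _ (X : bimodType A B) :=
  GRing.isScalable.Build A (tensor X B^o) X *:%R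
    (@tensorR1 B X) (@tensorR1_scalable X).

Fact tensorL1_rscalable (M : bimodType A B) b :
  {morph @tensorL1 A M : t / t :* b}.
Proof.
elim/tensor_ind=> [a m|s t IHs IHt].
  by rewrite ract_pure !tensorL1_pure scale_ract.
by rewrite ractDl !raddfD /= IHs IHt ractDl.
Qed.
HB.instance Definition _ (M : bimodType A B) :=
  isRscalable.Build B (tensor A^o M) M
    (@tensorL1 A M) (@tensorL1_rscalable M).
End TensorUnitBimodule.

HB.instance Definition _ (A B : pzRingType) (X : bimodType A B) :=
  Rlinear.on (@tensorR1 B X).
HB.instance Definition _ (A B : pzRingType) (M : bimodType A B) :=
  Rlinear.on (@tensorL1 A M).

Arguments tensorA {A B X M N}.
Arguments tensorAV {A B X M N}.
Arguments tensorR1 {A X}.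
Arguments tensorL1 {A M}.

Notation "''id[' X ]" := (@idfun X%type) : ring_scope.

(* Unbracketed iterated tensor products are read as bracketed to the left; the *)
(* associativity and unit isomorphisms are inserted where the brackets differ. *)

Record coring (A : pzRingType) := Coring {
  coring_sort :> bimodType A A;
  comul : {bihom coring_sort -> coring_sort ⊗ coring_sort};
  counit : {bihom coring_sort -> A^o};
  comulA : ('id[coring_sort] <⊗> comul) \o comul
           =1 tensorA \o (comul <⊗> 'id[coring_sort]) \o comul;
  comul_counitr : tensorR1 \o ('id[coring_sort] <⊗> counit) \o comul =1 id;
  comul_counitl : tensorL1 \o (counit <⊗> 'id[coring_sort]) \o comul =1 id
}.

Record comodule (A : pzRingType) (C : coring A) := Comodule {
  comodule_sort :> rmodType A;
  coaction : {rlinear comodule_sort -> comodule_sort ⊗ C};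
  coactionA : tensorA \o (coaction <⊗> 'id[C]) \o coaction
              =1 ('id[comodule_sort] <⊗> comul C) \o coaction;
  coaction_counit : tensorR1 \o ('id[comodule_sort] <⊗> counit C) \o coaction =1 id
}.

Definition colinear (A : pzRingType) (C : coring A) (X X' : comodule C)
    (f : {rlinear X -> X'}) : Prop :=
  coaction X' \o f =1 (f <⊗> 'id[C]) \o coaction X.

Record one_cell (A B : pzRingType) (D : coring B) (C : coring A) := OneCell {
  cell_M : bimodType A B;
  cell_N : bimodType B A;
  cell_m : {bihom C ⊗ cell_M -> cell_M ⊗ D};
  cell_n : {bihom D ⊗ cell_N -> cell_N ⊗ C};
  cell_eta : {bihom (C ⊗ cell_M) ⊗ cell_N -> A^o};
  cell_rho : {bihom (D ⊗ cell_N) ⊗ cell_M -> B^o};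
  cell_m_counit :
    tensorR1 \o ('id[cell_M] <⊗> counit D) \o cell_m
    =1 tensorL1 \o (counit C <⊗> 'id[cell_M]);
  cell_m_comul :
    tensorA \o (cell_m <⊗> 'id[D]) \o tensorAV \o ('id[C] <⊗> cell_m) \o tensorA
      \o (comul C <⊗> 'id[cell_M])
    =1 ('id[cell_M] <⊗> comul D) \o cell_m;
  cell_n_counit :
    tensorR1 \o ('id[cell_N] <⊗> counit C) \o cell_n
    =1 tensorL1 \o (counit D <⊗> 'id[cell_N]);
  cell_n_comul :
    tensorA \o (cell_n <⊗> 'id[C]) \o tensorAV \o ('id[D] <⊗> cell_n) \o tensorA
      \o (comul D <⊗> 'id[cell_N])
    =1 ('id[cell_N] <⊗> comul C) \o cell_n;
  cell_eta_comul :
    tensorL1 \o (cell_eta <⊗> 'id[C]) \o tensorAV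
      \o ('id[C ⊗ cell_M] <⊗> cell_n) \o tensorA
      \o ((tensorAV \o ('id[C] <⊗> cell_m) \o tensorA) <⊗> 'id[cell_N])
      \o ((comul C <⊗> 'id[cell_M]) <⊗> 'id[cell_N])
    =1 tensorR1 \o ('id[C] <⊗> cell_eta) \o tensorA \o (tensorA <⊗> 'id[cell_N])
      \o ((comul C <⊗> 'id[cell_M]) <⊗> 'id[cell_N]);
  cell_rho_comul :
    tensorL1 \o (cell_rho <⊗> 'id[D]) \o tensorAV
      \o ('id[D ⊗ cell_N] <⊗> cell_m) \o tensorA
      \o ((tensorAV \o ('id[D] <⊗> cell_n) \o tensorA) <⊗> 'id[cell_M])
      \o ((comul D <⊗> 'id[cell_N]) <⊗> 'id[cell_M])
    =1 tensorR1 \o ('id[D] <⊗> cell_rho) \o tensorA \o (tensorA <⊗> 'id[cell_M])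
      \o ((comul D <⊗> 'id[cell_N]) <⊗> 'id[cell_M]);
  cell_eta_rho :
    tensorL1 \o (cell_eta <⊗> 'id[cell_M])
    =1 tensorR1 \o ('id[cell_M] <⊗> cell_rho) \o tensorA
      \o (tensorA <⊗> 'id[cell_M]) \o ((cell_m <⊗> 'id[cell_N]) <⊗> 'id[cell_M]);
  cell_rho_eta :
    tensorL1 \o (cell_rho <⊗> 'id[cell_N])
    =1 tensorR1 \o ('id[cell_N] <⊗> cell_eta) \o tensorA
      \o (tensorA <⊗> 'id[cell_N]) \o ((cell_n <⊗> 'id[cell_M]) <⊗> 'id[cell_N])
}.
Arguments cell_m_counit {A B D C} o x : rename.
Arguments cell_m_comul {A B D C} o x : rename.
Arguments cell_n_counit {A B D C} o x : rename.
Arguments cell_n_comul {A B D C} o x : rename.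
Arguments cell_eta_comul {A B D C} o x : rename.
Arguments cell_rho_comul {A B D C} o x : rename.
Arguments cell_eta_rho {A B D C} o x : rename.
Arguments cell_rho_eta {A B D C} o x : rename.

Section TensorMapTheory.
Variables (A : pzRingType).

Lemma tensor_map_comp (X X' X'' : rmodType A) (M M' M'' : lmodType A)
    (f' : {rlinear X' -> X''}) (f : {rlinear X -> X'})
    (g' : {linear M' -> M''}) (g : {linear M -> M'}) t :
  (f' <⊗> g') ((f <⊗> g) t) = ((f' \o f) <⊗> (g' \o g)) t.
Proof.
elim/tensor_ind: t => [x m|s t IHs IHt]; first by rewrite !tensor_map_pure.
by rewrite !raddfD /= IHs IHt.
Qed.

Lemma eq_tensor_map (X X' : rmodType A) (M M' : lmodType A)
    (f f' : {rlinear X -> X'}) (g g' : {linear M -> M'}) :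
  f =1 f' -> g =1 g' -> f <⊗> g =1 f' <⊗> g'.
Proof.
move=> ff gg t.
elim/tensor_ind: t => [x m|s t IHs IHt]; first by rewrite !tensor_map_pure ff gg.
by rewrite !raddfD /= IHs IHt.
Qed.

Lemma tensor_map_id (X : rmodType A) (M : lmodType A) :
  'id[X] <⊗> 'id[M] =1 id.
Proof.
elim/tensor_ind=> [x m|s t IHs IHt]; first by rewrite tensor_map_pure.
by rewrite raddfD /= IHs IHt.
Qed.

Lemma tensor_mapDl (X X' : rmodType A) (M M' : lmodType A)
    (f f' h : {rlinear X -> X'}) (g : {linear M -> M'}) :
  (forall x, h x = f x + f' x) ->
  forall t, (h <⊗> g) t = (f <⊗> g) t + (f' <⊗> g) t.
Proof.
move=> hE; elim/tensor_ind=> [x m|s t IHs IHt].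
  by rewrite !tensor_map_pure hE pureDl.
by rewrite !raddfD /= IHs IHt addrACA.
Qed.
End TensorMapTheory.

Section Pushout.
Variables (A B : pzRingType) (C : coring A) (D : coring B).
Variables (M : bimodType A B) (m : {bihom C ⊗ M -> M ⊗ D}).

Definition pushout_coaction (X : comodule C) : X ⊗ M -> (X ⊗ M) ⊗ D :=
  tensorAV \o ('id[X] <⊗> m) \o tensorA \o (coaction X <⊗> 'id[M]).
Arguments pushout_coaction : clear implicits, simpl never.
HB.instance Definition _ (X : comodule C) := Rlinear.on (pushout_coaction X).

Lemma pushout_coaction_pure (X : comodule C) (x : X) (u : M) :
  pushout_coaction X (x ⊗ u) =
  tensorAV (('id[X] <⊗> m) (tensorA (coaction X x ⊗ u))).
Proof. by rewrite /pushout_coaction /= tensor_map_pure. Qed.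

Hypothesis m_counit :
  tensorR1 \o ('id[M] <⊗> counit D) \o m =1 tensorL1 \o (counit C <⊗> 'id[M]).
Hypothesis m_comul :
  tensorA \o (m <⊗> 'id[D]) \o tensorAV \o ('id[C] <⊗> m) \o tensorA
    \o (comul C <⊗> 'id[M]) =1 ('id[M] <⊗> comul D) \o m.

Section Object.
Variable X : comodule C.

Fact pushout_counit :
  tensorR1 \o ('id[X ⊗ M] <⊗> counit D) \o pushout_coaction X =1 id.
Proof.
elim/tensor_ind=> [x u|s t IHs IHt]; last first.
  by rewrite raddfD /=; move: IHs IHt => /= -> ->.
rewrite /= pushout_coaction_pure.
have E1 v : tensorR1 (('id[X ⊗ M] <⊗> counit D) (tensorAV v)) =
    ('id[X] <⊗> (tensorR1 \o ('id[M] <⊗> counit D))) v.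
  elim/tensor3V_ind: v => [y w d|s t IHs IHt].
    by rewrite tensorAV_pure !tensor_map_pure /= tensor_map_pure !tensorR1_pure ract_pure.
  by rewrite !raddfD /= IHs IHt.
rewrite E1 tensor_map_comp /=.
rewrite (eq_tensor_map (f' := 'id[X]) (g' := tensorL1 \o (counit C <⊗> 'id[M])) _ m_counit) //.
rewrite -[in RHS](coaction_counit x) /=.
elim/tensor_ind: (coaction X x) => [y c|s t IHs IHt].
  rewrite tensorA_pure !tensor_map_pure /= tensor_map_pure tensorR1_pure.
  by rewrite tensorL1_pure pureA.
by rewrite pureDl !raddfD /= IHs IHt pureDl.
Qed.

Fact pushout_comul :
  tensorA \o (pushout_coaction X <⊗> 'id[D]) \o pushout_coaction X
  =1 ('id[X ⊗ M] <⊗> comul D) \o pushout_coaction X.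
Proof.
move=> t; apply: (can_inj (@tensorAK A B X M (D ⊗ D)%type)); rewrite /=.
set w := tensorA ((coaction X <⊗> 'id[M]) t).
have -> : pushout_coaction X t = tensorAV (('id[X] <⊗> m) w) by [].
have ER v : tensorA (('id[X ⊗ M] <⊗> comul D) (tensorAV v)) =
    ('id[X] <⊗> ('id[M] <⊗> comul D)) v.
  elim/tensor3V_ind: v => [y u d|s s' IHs IHs'].
    by rewrite tensorAV_pure !tensor_map_pure /= tensorA_pure tensor_map_pure.
  by rewrite !raddfD /= IHs IHs'.
have EL v : tensorA (tensorA ((pushout_coaction X <⊗> 'id[D]) (tensorAV v))) =
    ('id[X] <⊗> (tensorA \o (m <⊗> 'id[D]) \o tensorAV))
      (tensorA ((coaction X <⊗> 'id[M ⊗ D]) v)).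
  elim/tensor3V_ind: v => [y u d|s s' IHs IHs'].
    rewrite tensorAV_pure !tensor_map_pure /= pushout_coaction_pure.
    elim/tensor_ind: (coaction X y) => [z c|s s' IHs IHs']; last first.
      by rewrite !pureDl !raddfD /= pureDl !raddfD /= IHs IHs'.
    rewrite !tensorA_pure !tensor_map_pure /= tensorAV_pure tensor_map_pure /=.
    elim/tensor_ind: (m (c ⊗ u)) => [u' d'|s s' IHs IHs'].
      by rewrite tensorAV_pure !tensorA_pure.
    by rewrite pureDr raddfD /= !pureDl !raddfD /= IHs IHs' pureDr.
  by rewrite !raddfD /= IHs IHs'.
have EM : tensorA ((coaction X <⊗> 'id[M ⊗ D]) (('id[X] <⊗> m) w)) =
    ('id[X] <⊗> ('id[C] <⊗> m)) (tensorA ((coaction X <⊗> 'id[C ⊗ M]) w)).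
  elim/tensor_ind: w => [x v|s s' IHs IHs']; last by rewrite !raddfD /= IHs IHs'.
  rewrite !tensor_map_pure /=.
  elim/tensor_ind: (coaction X x) => [y c|s s' IHs IHs'].
    by rewrite !tensorA_pure !tensor_map_pure /= tensor_map_pure.
  by rewrite !pureDl !raddfD /= IHs IHs'.
have EX : tensorA ((coaction X <⊗> 'id[C ⊗ M]) w) =
    ('id[X] <⊗> (tensorA \o (comul C <⊗> 'id[M]))) w.
  rewrite /w {EM w}; elim/tensor_ind: t => [x u|s s' IHs IHs']; last first.
    by rewrite !raddfD /= IHs IHs'.
  rewrite tensor_map_pure /=.
  have E1 (s : X ⊗ C) : tensorA ((coaction X <⊗> 'id[C ⊗ M]) (tensorA (s ⊗ u))) =
      ('id[X] <⊗> tensorA) (tensorA (tensorA ((coaction X <⊗> 'id[C]) s) ⊗ u)).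
    elim/tensor_ind: s => [y c|s s' IHs IHs']; last first.
      by rewrite !raddfD /= !pureDl !raddfD /= IHs IHs'.
    rewrite tensorA_pure !tensor_map_pure /=.
    elim/tensor_ind: (coaction X y) => [z c'|s s' IHs IHs'].
      by rewrite !tensorA_pure tensor_map_pure /= tensorA_pure.
    by rewrite !pureDl !raddfD /= pureDl !raddfD /= IHs IHs'.
  have E2 (s : X ⊗ C) :
      ('id[X] <⊗> tensorA) (tensorA (('id[X] <⊗> comul C) s ⊗ u)) =
      ('id[X] <⊗> (tensorA \o (comul C <⊗> 'id[M]))) (tensorA (s ⊗ u)).
    elim/tensor_ind: s => [y c|s s' IHs IHs'].
      by rewrite tensor_map_pure /= !tensorA_pure !tensor_map_pure /= ?tensor_map_pure.
    by rewrite !pureDl !raddfD /= !pureDl !raddfD /= IHs IHs'.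
  by rewrite E1 -E2; have /= -> := coactionA x.
rewrite ER EL EM EX !tensor_map_comp.
exact: eq_tensor_map.
Qed.

Definition pushout_comodule : comodule D :=
  @Comodule B D (tensor X M) (pushout_coaction X) pushout_comul pushout_counit.
End Object.

Fact pushout_colinear (X X' : comodule C) (f : {rlinear X -> X'}) :
  colinear f ->
  colinear (f <⊗> 'id[M] : {rlinear pushout_comodule X -> pushout_comodule X'}).
Proof.
move=> fC; elim/tensor_ind=> [x u|s t IHs IHt]; last first.
  by rewrite !raddfD; move: IHs IHt => /= -> ->.
rewrite /= tensor_map_pure !pushout_coaction_pure.
have /= -> := fC x.
elim/tensor_ind: (coaction X x) => [y c|s t IHs IHt].
  rewrite tensor_map_pure !tensorA_pure !tensor_map_pure /=.
  elim/tensor_ind: (m (c ⊗ u)) => [u' d|s t IHs IHt].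
    by rewrite !tensorAV_pure tensor_map_pure /= tensor_map_pure.
  by rewrite !pureDr !raddfD /= IHs IHt.
by rewrite raddfD /= !pureDl !raddfD /= IHs IHt.
Qed.
End Pushout.
Arguments pushout_coaction {A B C D M} m X t : simpl never.

Record preadditive := Preadditive {
  obj :> Type;
  hom : obj -> obj -> zmodType;
  idm : forall X, hom X X;
  compose : forall X Y Z, hom Y Z -> hom X Y -> hom X Z;
  compA : forall X Y Z T (h : hom Z T) (g : hom Y Z) (f : hom X Y),
    compose h (compose g f) = compose (compose h g) f;
  comp1m : forall X Y (f : hom X Y), compose (idm Y) f = f;
  compm1 : forall X Y (f : hom X Y), compose f (idm X) = f;
  compDl : forall X Y Z (g g' : hom Y Z) (f : hom X Y),
    compose (g + g') f = compose g f + compose g' f;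
  compDr : forall X Y Z (g : hom Y Z) (f f' : hom X Y),
    compose g (f + f') = compose g f + compose g f'
}.
Arguments hom {p} X Y.
Arguments idm {p} X.
Arguments compose {p X Y Z} g f.

Notation "g ∘ f" := (compose g f) : ring_scope.

Definition has_zero_object (K : preadditive) : Prop :=
  exists Z : K, forall X : K,
    (forall f : hom X Z, f = 0) /\ (forall f : hom Z X, f = 0).

Definition has_biproducts (K : preadditive) : Prop :=
  forall X Y : K, exists (S : K) (i : hom X S) (j : hom Y S)
                         (p : hom S X) (q : hom S Y),
    [/\ p ∘ i = idm X, q ∘ j = idm Y, p ∘ j = 0, q ∘ i = 0
      & i ∘ p + j ∘ q = idm S].

Definition is_additive_category (K : preadditive) : Prop :=
  has_zero_object K /\ has_biproducts K.

Definition is_cokernel (K : preadditive) (X Y Q : K) (f : hom X Y) (q : hom Y Q) :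
    Prop :=
  q ∘ f = 0 /\
  forall (Z : K) (g : hom Y Z), g ∘ f = 0 -> exists! u : hom Q Z, u ∘ q = g.

Definition has_cokernels (K : preadditive) : Prop :=
  forall (X Y : K) (f : hom X Y), exists (Q : K) (q : hom Y Q), is_cokernel f q.

Definition is_direct_sum (K : preadditive) (I : Type) (X : I -> K) (S : K)
    (inj : forall i, hom (X i) S) : Prop :=
  forall (Z : K) (g : forall i, hom (X i) Z),
    exists! u : hom S Z, forall i, u ∘ inj i = g i.

Definition has_direct_sums (K : preadditive) : Prop :=
  forall (I : Type) (X : I -> K), exists (S : K) (inj : forall i, hom (X i) S),
    is_direct_sum inj.

Record functor (K L : preadditive) := Functor {
  fobj :> K -> L;
  fmap : forall X Y, hom X Y -> hom (fobj X) (fobj Y);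
  fmap1 : forall X, fmap (idm X) = idm (fobj X);
  fmapM : forall X Y Z (g : hom Y Z) (f : hom X Y), fmap (g ∘ f) = fmap g ∘ fmap f
}.
Arguments fmap {K L} f {X Y} _ : rename.

Definition functor_id (K : preadditive) : functor K K :=
  @Functor K K id (fun _ _ f => f) (fun _ => erefl) (fun _ _ _ _ _ => erefl).

Section FunctorComp.
Variables (K L E : preadditive) (G : functor L E) (F : functor K L).

Fact functor_comp1 X : fmap G (fmap F (idm X)) = idm (G (F X)).
Proof. by rewrite !fmap1. Qed.

Fact functor_compM X Y Z (g : hom Y Z) (f : hom X Y) :
  fmap G (fmap F (g ∘ f)) = fmap G (fmap F g) ∘ fmap G (fmap F f).
Proof. by rewrite !fmapM. Qed.

Definition functor_comp : functor K E :=
  @Functor K E (fun X => G (F X)) (fun _ _ f => fmap G (fmap F f))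
    functor_comp1 functor_compM.
End FunctorComp.

Record nat_trans (K L : preadditive) (F G : functor K L) := NatTrans {
  nat_app :> forall X, hom (F X) (G X);
  nat_natural : forall X Y (f : hom X Y), nat_app Y ∘ fmap F f = fmap G f ∘ nat_app X
}.

Definition is_additive_functor (K L : preadditive) (F : functor K L) : Prop :=
  forall X Y (f g : hom X Y), fmap F (f + g) = fmap F f + fmap F g.

Definition preserves_cokernels (K L : preadditive) (F : functor K L) : Prop :=
  forall (X Y Q : K) (f : hom X Y) (q : hom Y Q),
    is_cokernel f q -> is_cokernel (fmap F f) (fmap F q).

Record wide_right_Morita_context (K L : preadditive)
    (F : functor L K) (G : functor K L)
    (eta : nat_trans (functor_comp F G) (functor_id K))
    (rho : nat_trans (functor_comp G F) (functor_id L)) : Prop := {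
  wide_additive_l : is_additive_category K;
  wide_cokernels_l : has_cokernels K;
  wide_direct_sums_l : has_direct_sums K;
  wide_additive_r : is_additive_category L;
  wide_cokernels_r : has_cokernels L;
  wide_direct_sums_r : has_direct_sums L;
  wide_F_additive : is_additive_functor F;
  wide_F_cokernels : preserves_cokernels F;
  wide_G_additive : is_additive_functor G;
  wide_G_cokernels : preserves_cokernels G;
  wide_eta : forall Y : L, eta (F Y) = fmap F (rho Y);
  wide_rho : forall X : K, rho (G X) = fmap G (eta X)
}.

Section RlinearZmod.
Variables (A : pzRingType) (U V : rmodType A) (f g : {rlinear U -> V}).

Lemma ract0 (v : V) (a : A) : (0 : V) :* a = 0.
Proof. by apply: (addrI (0 :* a)); rewrite -ractDl !addr0. Qed.

Lemma ractN (a : A) (v : V) : (- v) :* a = - (v :* a).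
Proof. by apply/eqP; rewrite -addr_eq0 -ractDl addNr (ract0 v). Qed.

Fact null_fun_rscalable (a : A) :
  {morph (\0 : U -> V) : u / u :* a}.
Proof. by move=> u; rewrite (ract0 0). Qed.
HB.instance Definition _ :=
  isRscalable.Build A U V (\0 : U -> V) null_fun_rscalable.

Fact add_fun_rscalable a : {morph f \+ g : u / u :* a}.
Proof. by move=> u; rewrite /= !rlinearZ ractDl. Qed.
HB.instance Definition _ := isRscalable.Build A U V (f \+ g) add_fun_rscalable.

Fact opp_fun_rscalable a : {morph \- f : u / u :* a}.
Proof. by move=> u; rewrite /= !rlinearZ ractN. Qed.
HB.instance Definition _ := isRscalable.Build A U V (\- f) opp_fun_rscalable.

Lemma rlinear_eq : f =1 g -> f = g.
Proof.
move=> fg; have {fg} : f = g :> (U -> V) by apply/funext.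
case: f g => [f1 cf] [g1 cg] /= fg; subst g1; congr Rlinear.Pack.
case: cf cg => [[[f0 fD]] [fZ]] [[[g0 gD]] [gZ]].
by rewrite (Prop_irrelevance f0 g0) (Prop_irrelevance fD gD) (Prop_irrelevance fZ gZ).
Qed.
End RlinearZmod.

Record comodule_hom (A : pzRingType) (C : coring A) (X X' : comodule C) :=
  ComoduleHom {
    comodule_hom_fun :> {rlinear X -> X'};
    comodule_homP : colinear comodule_hom_fun
  }.

Section ComoduleCategory.
Variables (A : pzRingType) (C : coring A).

Lemma comodule_hom_eq (X X' : comodule C) (f g : comodule_hom X X') :
  f =1 g -> f = g.
Proof.
case: f g => [f fC] [g gC] /= /rlinear_eq fg; subst g.
by rewrite (Prop_irrelevance fC gC).
Qed.

Section HomZmod.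
Variables X X' : comodule C.
Local Notation homXX := (comodule_hom X X').

HB.instance Definition _ := gen_eqMixin homXX.
HB.instance Definition _ := gen_choiceMixin homXX.

Fact colinear0 : colinear (\0 : {rlinear X -> X'}).
Proof.
move=> x; rewrite /= raddf0; symmetry.
elim/tensor_ind: (coaction X x) => [y c|s t IHs IHt].
  by rewrite tensor_map_pure /= -[0 in LHS](subrr 0) pureDl pureNl subrr.
by rewrite raddfD /= IHs IHt addr0.
Qed.

Fact colinearD (f g : homXX) : colinear (f \+ g : {rlinear X -> X'}).
Proof.
move=> x; rewrite /= raddfD /=.
have /= -> := comodule_homP f x; have /= -> := comodule_homP g x.
by rewrite -(@tensor_mapDl _ _ _ _ _ f g (f \+ g : {rlinear X -> X'})).
Qed.

Fact colinearN (f : homXX) : colinear (\- f : {rlinear X -> X'}).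
Proof.
move=> x; rewrite /= raddfN /=; have /= -> := comodule_homP f x.
elim/tensor_ind: (coaction X x) => [y c|s t IHs IHt].
  by rewrite !tensor_map_pure /= pureNl.
by rewrite !raddfD /= IHs IHt.
Qed.

Definition comodule_hom0 : homXX := ComoduleHom colinear0.
Definition comodule_hom_add (f g : homXX) : homXX := ComoduleHom (colinearD f g).
Definition comodule_hom_opp (f : homXX) : homXX := ComoduleHom (colinearN f).

Fact comodule_hom_addA : associative comodule_hom_add.
Proof. by move=> f g h; apply: comodule_hom_eq => x /=; rewrite addrA. Qed.
Fact comodule_hom_addC : commutative comodule_hom_add.
Proof. by move=> f g; apply: comodule_hom_eq => x /=; rewrite addrC. Qed.
Fact comodule_hom_add0 : left_id comodule_hom0 comodule_hom_add.
Proof. by move=> f; apply: comodule_hom_eq => x /=; rewrite add0r. Qed.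
Fact comodule_hom_addN : left_inverse comodule_hom0 comodule_hom_opp comodule_hom_add.
Proof. by move=> f; apply: comodule_hom_eq => x /=; rewrite addNr. Qed.

HB.instance Definition _ := GRing.isZmodule.Build homXX
  comodule_hom_addA comodule_hom_addC comodule_hom_add0 comodule_hom_addN.
End HomZmod.

Fact colinear_id (X : comodule C) : colinear 'id[X].
Proof. by move=> x; rewrite /= tensor_map_id. Qed.

Fact colinear_comp (X Y Z : comodule C)
    (g : comodule_hom Y Z) (f : comodule_hom X Y) :
  colinear (g \o f : {rlinear X -> Z}).
Proof.
move=> x /=; have /= -> := comodule_homP g (f x); have /= -> := comodule_homP f x.
by rewrite tensor_map_comp; apply: eq_tensor_map.
Qed.

Definition comodule_id (X : comodule C) : comodule_hom X X :=
  ComoduleHom (@colinear_id X).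
Definition comodule_comp (X Y Z : comodule C)
    (g : comodule_hom Y Z) (f : comodule_hom X Y) : comodule_hom X Z :=
  ComoduleHom (colinear_comp g f).

Fact comodule_compA (X Y Z T : comodule C) (h : comodule_hom Z T)
    (g : comodule_hom Y Z) (f : comodule_hom X Y) :
  comodule_comp h (comodule_comp g f) = comodule_comp (comodule_comp h g) f.
Proof. exact: comodule_hom_eq. Qed.

Fact comodule_comp1m (X Y : comodule C) (f : comodule_hom X Y) :
  comodule_comp (comodule_id Y) f = f.
Proof. exact: comodule_hom_eq. Qed.

Fact comodule_compm1 (X Y : comodule C) (f : comodule_hom X Y) :
  comodule_comp f (comodule_id X) = f.
Proof. exact: comodule_hom_eq. Qed.

Fact comodule_compDl (X Y Z : comodule C) (g g' : comodule_hom Y Z)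
    (f : comodule_hom X Y) :
  comodule_comp (g + g') f = comodule_comp g f + comodule_comp g' f.
Proof. exact: comodule_hom_eq. Qed.

Fact comodule_compDr (X Y Z : comodule C) (g : comodule_hom Y Z)
    (f f' : comodule_hom X Y) :
  comodule_comp g (f + f') = comodule_comp g f + comodule_comp g f'.
Proof. by apply: comodule_hom_eq => x /=; rewrite raddfD. Qed.

Definition comodule_category : preadditive :=
  @Preadditive (comodule C) (fun X X' => comodule_hom X X' : zmodType)
    comodule_id comodule_comp comodule_compA comodule_comp1m comodule_compm1
    comodule_compDl comodule_compDr.
End ComoduleCategory.

Section PushoutFunctor.
Variables (A B : pzRingType) (C : coring A) (D : coring B).
Variables (M : bimodType A B) (m : {bihom C ⊗ M -> M ⊗ D}).
Hypothesis m_counit :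
  tensorR1 \o ('id[M] <⊗> counit D) \o m =1 tensorL1 \o (counit C <⊗> 'id[M]).
Hypothesis m_comul :
  tensorA \o (m <⊗> 'id[D]) \o tensorAV \o ('id[C] <⊗> m) \o tensorA
    \o (comul C <⊗> 'id[M]) =1 ('id[M] <⊗> comul D) \o m.

Let P := pushout_comodule m_counit m_comul.

Definition pushout_hom (X X' : comodule C) (f : comodule_hom X X') :
    comodule_hom (P X) (P X') :=
  ComoduleHom (pushout_colinear (m_counit := m_counit) (m_comul := m_comul) (comodule_homP f)).

Fact pushout_hom1 (X : comodule C) :
  pushout_hom (comodule_id X) = comodule_id (P X).
Proof. by apply: comodule_hom_eq => t /=; apply: tensor_map_id. Qed.

Fact pushout_homM (X Y Z : comodule C) (g : comodule_hom Y Z)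
    (f : comodule_hom X Y) :
  pushout_hom (comodule_comp g f) =
  comodule_comp (pushout_hom g) (pushout_hom f).
Proof.
apply: comodule_hom_eq => t /=; rewrite tensor_map_comp.
exact: eq_tensor_map.
Qed.

Definition pushout_functor :
    functor (comodule_category C) (comodule_category D) :=
  @Functor (comodule_category C) (comodule_category D) P pushout_hom
    pushout_hom1 pushout_homM.
End PushoutFunctor.

Section OneCell.
Variables (A B : pzRingType) (C : coring A) (D : coring B).
Variable Gamma : one_cell D C.
Local Notation M := (cell_M Gamma).
Local Notation N := (cell_N Gamma).

Definition functor_M : functor (comodule_category C) (comodule_category D) :=
  pushout_functor (cell_m_counit Gamma) (cell_m_comul Gamma).

Definition functor_N : functor (comodule_category D) (comodule_category C) :=
  pushout_functor (cell_n_counit Gamma) (cell_n_comul Gamma).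

Definition eta_tilde (X : comodule C) : {rlinear (X ⊗ M) ⊗ N -> X} :=
  tensorR1 \o ('id[X] <⊗> cell_eta Gamma) \o tensorA \o (tensorA <⊗> 'id[N])
    \o ((coaction X <⊗> 'id[M]) <⊗> 'id[N]).

Definition rho_tilde (Y : comodule D) : {rlinear (Y ⊗ N) ⊗ M -> Y} :=
  tensorR1 \o ('id[Y] <⊗> cell_rho Gamma) \o tensorA \o (tensorA <⊗> 'id[M])
    \o ((coaction Y <⊗> 'id[N]) <⊗> 'id[M]).
End OneCell.

(* Main.v *)
(* In Sweedler notation [eta_tilde X (x ⊗ u ⊗ v) = x0 (eta (x1 ⊗ u ⊗ v))].
   Colinearity follows from the compatibility of [eta] with the comultiplication
   and from coassociativity of the coaction; the identity
   [eta_tilde (N Y) = N (rho_tilde Y)] is [cell_rho_eta] applied in the second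
   tensor factor of the coaction of [Y].  Direct sums and cokernels of comodules
   are those of modules: the coaction is induced by the universal property, which
   for cokernels uses only that [- ⊗ C] preserves [q \o f = 0].  Hence a colinear
   [q] is a cokernel of [f] iff [X -> Y -> Q -> 0] is exact in modules, and
   [- ⊗ M] preserves cokernels by right exactness. *)

From HB Require Import structures.
From mathcomp Require Import all_boot all_algebra.
From mathcomp Require Import boolp.
Require Import Defs.

Set Implicit Arguments.
Unset Strict Implicit.
Unset Printing Implicit Defensive.

Import GRing.Theory.

Local Open Scope ring_scope.

(** * Additivity and evaluation of module maps and tensor maps *)

Lemma rlinearD (A : pzRingType) (U V : rmodType A) (f : {rlinear U -> V}) u v :
  f (u + v) = f u + f v.
Proof. exact: raddfD. Qed.

Lemma rlinearB (A : pzRingType) (U V : rmodType A) (f : {rlinear U -> V}) u v :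
  f (u - v) = f u - f v.
Proof. exact: raddfB. Qed.

Lemma tensor_mapD (A : pzRingType) (X X' : rmodType A) (M M' : lmodType A)
    (f : {rlinear X -> X'}) (g : {linear M -> M'}) s t :
  (f <⊗> g) (s + t) = (f <⊗> g) s + (f <⊗> g) t.
Proof. exact: raddfD. Qed.

Lemma tensor_map3_pure (A B : pzRingType) (X X' : rmodType A)
    (M M' : bimodType A B) (N N' : lmodType B) (f : {rlinear X -> X'})
    (g : {bihom M -> M'}) (h : {linear N -> N'}) x u v :
  ((f <⊗> g) <⊗> h) ((x ⊗ u) ⊗ v) = (f x ⊗ g u) ⊗ h v.
Proof. by rewrite tensor_map_pure /= tensor_map_pure. Qed.

(* The conditions on a one-cell are symmetric in the two corings, so statements
   about [rho_tilde] are statements about [eta_tilde] of the swapped one-cell. *)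
Section OneCellSwap.
Variables (A B : pzRingType) (C : coring A) (D : coring B).
Variable Gamma : one_cell D C.

Definition one_cell_swap : one_cell C D :=
  OneCell (cell_n_counit Gamma) (cell_n_comul Gamma)
    (cell_m_counit Gamma) (cell_m_comul Gamma)
    (cell_rho_comul Gamma) (cell_eta_comul Gamma)
    (cell_rho_eta Gamma) (cell_eta_rho Gamma).

End OneCellSwap.

(** * Naturality, the Morita identity and colinearity of [eta_tilde] *)

Section EtaTilde.
Variables (A B : pzRingType) (C : coring A) (D : coring B).
Variable Gamma : one_cell D C.
Local Notation M := (cell_M Gamma).
Local Notation N := (cell_N Gamma).

Lemma eta_tilde_pure (X : comodule C) (x : X) (u : M) (v : N) :
  eta_tilde Gamma X ((x ⊗ u) ⊗ v) =
  tensorR1 (('id[X] <⊗> cell_eta Gamma)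
    (tensorA (tensorA (coaction X x ⊗ u) ⊗ v))).
Proof. by rewrite /eta_tilde /= !tensor_map_pure /= tensor_map_pure. Qed.

Lemma rho_tilde_pure (Y : comodule D) (y : Y) (v : N) (u : M) :
  rho_tilde Gamma Y ((y ⊗ v) ⊗ u) =
  tensorR1 (('id[Y] <⊗> cell_rho Gamma)
    (tensorA (tensorA (coaction Y y ⊗ v) ⊗ u))).
Proof. by rewrite /rho_tilde /= !tensor_map_pure /= tensor_map_pure. Qed.

(** Colinearity of [f] turns [coaction X' (f x)] into [f x0 ⊗ x1], and right linearity pulls [f] out
    of [f x0 :* eta (x1 ⊗ u ⊗ v)]. *)
Lemma eta_tilde_natural (X X' : comodule C) (f : {rlinear X -> X'}) :
  colinear f ->
  forall t, eta_tilde Gamma X' (((f <⊗> 'id[M]) <⊗> 'id[N]) t) = f (eta_tilde Gamma X t).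
Proof.
move=> fC; elim/tensor3_ind => [x u v|s t IHs IHt]; last first.
  by rewrite tensor_mapD !rlinearD IHs IHt.
rewrite tensor_map3_pure !eta_tilde_pure /=.
have /= E := fC x; rewrite E {E}.
elim/tensor_ind: (coaction X x) => [y c|s t IHs IHt]; last first.
  by rewrite raddfD /= !pureDl !raddfD /= !pureDl !raddfD /= IHs IHt.
by rewrite tensor_map_pure !tensorA_pure !tensor_map_pure !tensorR1_pure rlinearZ.
Qed.

Lemma eta_tilde_pushout (Y : comodule D) :
  eta_tilde Gamma (functor_N Gamma Y) =1 rho_tilde Gamma Y <⊗> 'id[N].
Proof.
elim/tensor3_ind => [t u v|s t IHs IHt]; last by rewrite tensor_mapD !rlinearD IHs IHt.
elim/tensor_ind: t => [y n|s t IHs IHt]; last first.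
  by rewrite !pureDl tensor_mapD !rlinearD IHs IHt.
have -> := @eta_tilde_pure (functor_N Gamma Y) (y ⊗ n) u v.
rewrite tensor_map_pure rho_tilde_pure /=.
rewrite pushout_coaction_pure.
elim/tensor_ind: (coaction Y y) => [z d|s t IHs IHt]; last first.
  by rewrite !(pureDl, raddfD) /= IHs IHt.
rewrite !tensorA_pure !tensor_map_pure /= tensorR1_pure.
(* The scalar [rho (d ⊗ n ⊗ u)] crosses the tensor sign from [z] to [v], where it forms the left
   side of [cell_rho_eta]. *)
rewrite pureA; have /= := cell_rho_eta Gamma (((d ⊗ n) ⊗ u) ⊗ v).
rewrite tensor_map3_pure !tensor_map_pure /= tensorL1_pure => ->.
elim/tensor_ind: (cell_n Gamma (d ⊗ n)) => [w c|s t IHs IHt]; last first.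
  by rewrite pureDr !(pureDl, raddfD) /= IHs IHt pureDr.
rewrite tensorAV_pure !tensorA_pure [in LHS]tensor_map_pure.
by rewrite [in RHS]tensor_map_pure !tensorR1_pure ract_pure.
Qed.

(* With [J] and [K], the two sides [Hl \o D3] and [Hr \o D3] of [cell_eta_comul]
   are evaluated on [x1 ⊗ u ⊗ v]; coassociativity of [X] brings both sides of
   colinearity to [x0 ⊗ Hl (D3 (x1 ⊗ u ⊗ v))] and [x0 ⊗ Hr (D3 (x1 ⊗ u ⊗ v))]. *)
Let J : {bihom (C ⊗ M) ⊗ N -> M ⊗ (N ⊗ C)} :=
  ('id[M] <⊗> cell_n Gamma) \o tensorA \o (cell_m Gamma <⊗> 'id[N]).

Let K : {bihom C ⊗ (M ⊗ (N ⊗ C)) -> C} :=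
  tensorL1 \o (cell_eta Gamma <⊗> 'id[C]) \o tensorAV \o tensorAV.

Let Hl : {bihom ((C ⊗ C) ⊗ M) ⊗ N -> C} :=
  tensorL1 \o (cell_eta Gamma <⊗> 'id[C]) \o tensorAV
      \o ('id[C ⊗ M] <⊗> cell_n Gamma) \o tensorA
      \o ((tensorAV \o ('id[C] <⊗> cell_m Gamma) \o tensorA) <⊗> 'id[N]).

Let Hr : {bihom ((C ⊗ C) ⊗ M) ⊗ N -> C} :=
  tensorR1 \o ('id[C] <⊗> cell_eta Gamma) \o tensorA \o (tensorA <⊗> 'id[N]).

Let D3 : {bihom (C ⊗ M) ⊗ N -> ((C ⊗ C) ⊗ M) ⊗ N} :=
  (comul C <⊗> 'id[M]) <⊗> 'id[N].

Let JE c u v : J ((c ⊗ u) ⊗ v) =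
  ('id[M] <⊗> cell_n Gamma) (tensorA (cell_m Gamma (c ⊗ u) ⊗ v)).
Proof. by rewrite /J /= tensor_map_pure. Qed.

Let KE (c : C) (u : M) (v : N) (c' : C) :
  K (c ⊗ (u ⊗ (v ⊗ c'))) = (cell_eta Gamma ((c ⊗ u) ⊗ v) : A) *: c'.
Proof. by rewrite /K /= !tensorAV_pure tensor_map_pure tensorL1_pure. Qed.

(** Splits [Hl] after its first tensor factor: [J] moves [c'] past [M] and [N] while [c] waits, then
    [K] evaluates [eta] at [c]. In this form [c] can come from a second use of the coaction of
    [X]. *)
Let HlE (c c' : C) (u : M) (v : N) :
  Hl (((c ⊗ c') ⊗ u) ⊗ v) = K (c ⊗ J ((c' ⊗ u) ⊗ v)).
Proof.
rewrite JE /Hl /= tensor_map_pure /= tensorA_pure tensor_map_pure /=.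
elim/tensor_ind: (cell_m Gamma (c' ⊗ u)) => [u' d|s t IHs IHt]; last first.
  by rewrite !(pureDr, pureDl, raddfD) /= IHs IHt.
by rewrite tensorAV_pure !tensorA_pure !tensor_map_pure /K /= tensorAV_pure.
Qed.

Let HrE (c c' : C) (u : M) (v : N) :
  Hr (((c ⊗ c') ⊗ u) ⊗ v) = c :* (cell_eta Gamma ((c' ⊗ u) ⊗ v) : A).
Proof.
by rewrite /Hr /= tensor_map_pure /= !tensorA_pure tensor_map_pure tensorR1_pure.
Qed.

Lemma eta_tilde_colinear (X : comodule C) :
  colinear (eta_tilde Gamma X : {rlinear functor_N Gamma (functor_M Gamma X) -> X}).
Proof.
elim/tensor3_ind => [x u v|s t IHs IHt]; last first.
  move: IHs IHt; rewrite /comp => IHs IHt.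
  by rewrite 3!rlinearD tensor_mapD IHs IHt.
(* [L s] lets the first factor of [s] coact once more and rebrackets into [X ⊗ (((C ⊗ C) ⊗ M) ⊗ N)],
   where [Hl] and [Hr] can be applied to the second factor. *)
pose L (s : X ⊗ C) := tensorA (tensorA (tensorA ((coaction X <⊗> 'id[C]) s) ⊗ u) ⊗ v).
(* Left side of colinearity: the coaction is right linear, so [eta (c ⊗ u ⊗ v)] ends up acting on
   the new [C]-factor, as in [HrE]. *)
have EL s : coaction X (tensorR1 (('id[X] <⊗> cell_eta Gamma)
    (tensorA (tensorA (s ⊗ u) ⊗ v)))) = ('id[X] <⊗> Hr) (L s).
  rewrite /L; elim/tensor_ind: s => [y c|s t IHs IHt]; last first.
    by rewrite !(pureDl, raddfD) /= IHs IHt.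
  rewrite !tensorA_pure !tensor_map_pure tensorR1_pure rlinearZ.
  elim/tensor_ind: (coaction X y) => [z d|s t IHs IHt]; last first.
    by rewrite ractDl !(pureDl, raddfD) /= IHs IHt.
  by rewrite !tensorA_pure tensor_map_pure ract_pure; congr (_ ⊗ _); exact/esym/HrE.
(* [E1] and [E2] compute [eta_tilde X] on outputs of [n] and of [m]: its own coaction on [z]
   supplies the first argument of [K]. *)
have E1 (z : X) (p : M) (w : N ⊗ C) :
    (eta_tilde Gamma X <⊗> 'id[C]) (tensorAV ((z ⊗ p) ⊗ w)) =
    ('id[X] <⊗> K) (tensorA (coaction X z ⊗ (p ⊗ w))).
  elim/tensor_ind: w => [q c|s t IHs IHt]; last first.
    by rewrite !(pureDr, raddfD) /= IHs IHt.
  rewrite tensorAV_pure tensor_map_pure eta_tilde_pure.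
  elim/tensor_ind: (coaction X z) => [y d|s t IHs IHt]; last first.
    by rewrite !(pureDl, raddfD) /= IHs IHt.
  rewrite !tensorA_pure !tensor_map_pure tensorR1_pure pureA; congr (_ ⊗ _).
  exact/esym/KE.
have E2 (z : X) (w : M ⊗ D) :
    (eta_tilde Gamma X <⊗> 'id[C])
      (tensorAV (('id[X ⊗ M] <⊗> cell_n Gamma) (tensorA (tensorAV (z ⊗ w) ⊗ v)))) =
    ('id[X] <⊗> K) (tensorA (coaction X z ⊗
      ('id[M] <⊗> cell_n Gamma) (tensorA (w ⊗ v)))).
  elim/tensor_ind: w => [q c|s t IHs IHt]; last first.
    by rewrite !(pureDr, pureDl, raddfD) /= IHs IHt.
  by rewrite tensorAV_pure !tensorA_pure !tensor_map_pure E1.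
(* Right side of colinearity, with the coaction of [N (M X)] written out for a general [s] in place
   of [coaction X x]. *)
have ER s : (eta_tilde Gamma X <⊗> 'id[C])
    (tensorAV (('id[X ⊗ M] <⊗> cell_n Gamma)
      (tensorA (tensorAV (('id[X] <⊗> cell_m Gamma) (tensorA (s ⊗ u))) ⊗ v)))) =
    ('id[X] <⊗> Hl) (L s).
  rewrite /L; elim/tensor_ind: s => [y c|s t IHs IHt]; last first.
    by rewrite !(pureDl, raddfD) /= IHs IHt.
  rewrite tensorA_pure !tensor_map_pure E2 -JE.
  elim/tensor_ind: (coaction X y) => [z d|s t IHs IHt]; last first.
    by rewrite !(pureDl, raddfD) /= IHs IHt.
  by rewrite !tensorA_pure !tensor_map_pure; congr (_ ⊗ _); exact/esym/HlE.
(* Coassociativity trades the second coaction on [X] for [comul C], so both sides factor through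
   [D3] and [cell_eta_comul] applies. *)
have LE : L (coaction X x) = ('id[X] <⊗> D3) (tensorA (tensorA (coaction X x ⊗ u) ⊗ v)).
  have /= E := coactionA x; rewrite /L E {E}.
  elim/tensor_ind: (coaction X x) => [y c|s t IHs IHt]; last first.
    by rewrite !(pureDl, raddfD) /= IHs IHt.
  by rewrite !tensor_map_pure !tensorA_pure !tensor_map_pure /D3 /= tensor_map3_pure.
rewrite /comp eta_tilde_pure EL.
transitivity (('id[X] <⊗> Hl) (L (coaction X x))); last first.
  rewrite -ER.
  congr (tensor_map _ _ _).
  rewrite /= pushout_coaction_pure /=.
  by rewrite pushout_coaction_pure.
rewrite LE !tensor_map_comp; apply: eq_tensor_map => // t.
symmetry; exact: cell_eta_comul.
Qed.
End EtaTilde.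

(** * Direct sums make a preadditive category additive *)

Section CoproductBiproduct.
Variable K : preadditive.

Lemma coproduct_ext (I : Type) (X : I -> K) (S : K) (inj : forall i, hom (X i) S) :
  is_direct_sum inj -> forall (Z : K) (f g : hom S Z),
  (forall i, f ∘ inj i = g ∘ inj i) -> f = g.
Proof.
move=> dsS Z f g fg; have [u [_ uU]] := dsS Z (fun i => g ∘ inj i).
by rewrite -(uU f fg) -(uU g).
Qed.

Lemma comp0m (X Y Z : K) (f : hom X Y) : (0 : hom Y Z) ∘ f = 0.
Proof. by apply: (addrI (0 ∘ f)); rewrite -compDl !addr0. Qed.

Lemma compm0 (X Y Z : K) (g : hom Y Z) : g ∘ (0 : hom X Y) = 0.
Proof. by apply: (addrI (g ∘ 0)); rewrite -compDr !addr0. Qed.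

(** The empty sum is a zero object because its identity is zero. A sum indexed by [bool] is a
    biproduct: its projections are induced by an identity and a zero map, and
    [i ∘ p + j ∘ q = idm S] is checked on the two injections. *)
Lemma direct_sums_additive : has_direct_sums K -> is_additive_category K.
Proof.
move=> dsK; split.
  have [Z [inj dsZ]] := dsK False (fun i : False => match i with end).
  exists Z => X; have id0 : idm Z = 0 by apply: (coproduct_ext dsZ).
  by split=> f; rewrite -[f]comp1m -[f]compm1 id0 ?comp0m ?compm0.
move=> X Y; have [S [inj dsS]] := dsK bool (fun b => if b then X else Y).
have [p [pE _]] := dsS X (fun b => if b return hom (if b then X else Y) X
                                   then idm X else 0).
have [q [qE _]] := dsS Y (fun b => if b return hom (if b then X else Y) Y
                                   then 0 else idm Y).
exists S, (inj true), (inj false), p, q; split.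
- exact: (pE true).
- exact: (qE false).
- exact: (pE false).
- exact: (qE true).
apply: (coproduct_ext dsS) => b; rewrite compDl comp1m -!compA pE qE.
by case: b; rewrite compm1 compm0 ?addr0 ?add0r.
Qed.
End CoproductBiproduct.

(** * Direct sums of modules *)

Section DirectSumModule.
Variables (A : pzRingType) (I : choiceType) (X : I -> rmodType A).

(** Finite support is the mere existence of a bounding list, so the support is not data and elements
    with equal components are equal. *)
Record dsum := Dsum {
  dsum_fun :> forall i, X i;
  dsum_supp : exists s : seq I, forall i, i \notin s -> dsum_fun i = 0
}.

Lemma dsum_eq (f g : dsum) : (forall i, f i = g i) -> f = g.
Proof.
case: f g => [f fs] [g gs] /= fg.
have E : f = g by apply: functional_extensionality_dep.
subst g.
by rewrite (Prop_irrelevance fs gs).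
Qed.

HB.instance Definition _ := gen_eqMixin dsum.
HB.instance Definition _ := gen_choiceMixin dsum.

Fact dsum_zero_supp : exists s : seq I, forall i, i \notin s -> 0 = 0 :> X i.
Proof. by exists [::]. Qed.
Fact dsum_add_supp (f g : dsum) :
  exists s : seq I, forall i, i \notin s -> f i + g i = 0.
Proof.
have [[s fs] [t gt]] := (dsum_supp f, dsum_supp g).
by exists (s ++ t) => i; rewrite mem_cat negb_or => /andP[/fs-> /gt->]; rewrite addr0.
Qed.
Fact dsum_opp_supp (f : dsum) : exists s : seq I, forall i, i \notin s -> - f i = 0.
Proof. by have [s fs] := dsum_supp f; exists s => i /fs->; rewrite oppr0. Qed.
Fact dsum_act_supp (f : dsum) (a : A) :
  exists s : seq I, forall i, i \notin s -> f i :* a = 0.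
Proof. by have [s fs] := dsum_supp f; exists s => i /fs->; rewrite (ract0 (0 : X i)). Qed.

Definition dsum_zero := Dsum dsum_zero_supp.
Definition dsum_add (f g : dsum) := Dsum (dsum_add_supp f g).
Definition dsum_opp (f : dsum) := Dsum (dsum_opp_supp f).
Definition dsum_act (f : dsum) (a : A) := Dsum (dsum_act_supp f a).

Fact dsum_addA : associative dsum_add.
Proof. by move=> f g h; apply: dsum_eq => i /=; rewrite addrA. Qed.
Fact dsum_addC : commutative dsum_add.
Proof. by move=> f g; apply: dsum_eq => i /=; rewrite addrC. Qed.
Fact dsum_add0 : left_id dsum_zero dsum_add.
Proof. by move=> f; apply: dsum_eq => i /=; rewrite add0r. Qed.
Fact dsum_addN : left_inverse dsum_zero dsum_opp dsum_add.
Proof. by move=> f; apply: dsum_eq => i /=; rewrite addNr. Qed.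

HB.instance Definition _ := GRing.isZmodule.Build dsum
  dsum_addA dsum_addC dsum_add0 dsum_addN.

Fact dsum_actA f a b : dsum_act (dsum_act f a) b = dsum_act f (a * b).
Proof. by apply: dsum_eq => i /=; rewrite ractA. Qed.
Fact dsum_act1 f : dsum_act f 1 = f.
Proof. by apply: dsum_eq => i /=; rewrite ractr1. Qed.
Fact dsum_actDl a : {morph dsum_act^~ a : f g / f + g}.
Proof. by move=> f g; apply: dsum_eq => i /=; rewrite ractDl. Qed.
Fact dsum_actDr f : {morph dsum_act f : a b / a + b}.
Proof. by move=> a b; apply: dsum_eq => i /=; rewrite ractDr. Qed.

HB.instance Definition _ := Zmodule_isRmodule.Build A dsum
  dsum_actA dsum_act1 dsum_actDl dsum_actDr.

Section Injection.
Variable i : I.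

Fact dsum_inj_supp (x : X i) :
  exists s : seq I, forall j, j \notin s -> dfwith (fun j => 0 : X j) x j = 0.
Proof.
by exists [:: i] => j; rewrite inE eq_sym => ij; rewrite dfwith_out.
Qed.

Definition dsum_inj (x : X i) : dsum := Dsum (dsum_inj_supp x).

Lemma dsum_injE (x : X i) : dsum_inj x i = x.
Proof. exact: dfwith_in. Qed.

Lemma dsum_inj_out (x : X i) j : i != j -> dsum_inj x j = 0.
Proof. exact: dfwith_out. Qed.

Fact dsum_inj_zmod : zmod_morphism dsum_inj.
Proof.
move=> x y; apply: dsum_eq => j; have [<-|ij] := eqVneq i j.
  by rewrite dsum_injE [RHS]/= !dfwith_in.
by rewrite dsum_inj_out // [RHS]/= !dfwith_out // subr0.
Qed.
HB.instance Definition _ := GRing.isZmodMorphism.Build (X i) dsum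
  dsum_inj dsum_inj_zmod.

Fact dsum_inj_rscalable a : {morph dsum_inj : x / x :* a}.
Proof.
move=> x; apply: dsum_eq => j; have [<-|ij] := eqVneq i j.
  by rewrite dsum_injE [RHS]/= dfwith_in.
by rewrite dsum_inj_out // [RHS]/= dfwith_out // (ract0 (0 : X j)).
Qed.
HB.instance Definition _ := isRscalable.Build A (X i) dsum
  dsum_inj dsum_inj_rscalable.
End Injection.

(** At [j] only the term with [i = j] survives, and [uniq] makes it occur once; hence any
    duplicate-free list covering the support will do. *)
Lemma dsum_sum (f : dsum) (s : seq I) : uniq s ->
  (forall i, i \notin s -> f i = 0) -> f = \sum_(i <- s) dsum_inj (f i).
Proof.
move=> us fs; apply: dsum_eq => j.
pose ev := fun g : dsum => g j.
have -> : (\sum_(i <- s) dsum_inj (f i)) j = \sum_(i <- s) dsum_inj (f i) j.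
  by apply: (big_morph ev).
have [js|js] := boolP (j \in s).
  rewrite (bigD1_seq j) //= dfwith_in big1 ?addr0 // => i ij.
  by rewrite dfwith_out.
rewrite fs // big_seq big1 // => i si; rewrite dsum_inj_out //.
by apply: contraNneq js => <-.
Qed.

(** By [dsum_sum] the injections generate [dsum] additively; this reduces the comodule axioms below
    to single summands. *)
Lemma dsum_ext (V : zmodType) (f g : dsum -> V) :
  {morph f : x y / x + y} -> {morph g : x y / x + y} ->
  (forall i x, f (dsum_inj (i := i) x) = g (dsum_inj x)) -> f =1 g.
Proof.
move=> fD gD fg t; have [s ts] := dsum_supp t.
rewrite (@dsum_sum t (undup s)) ?undup_uniq // => [|i]; last by rewrite mem_undup => /ts.
have f0 : f 0 = 0 by apply: (addrI (f 0)); rewrite -fD !addr0.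
have g0 : g 0 = 0 by apply: (addrI (g 0)); rewrite -gD !addr0.
by rewrite (big_morph _ fD f0) (big_morph _ gD g0); apply: eq_bigr.
Qed.

Section Lift.
Variables (V : rmodType A) (g : forall i, {rlinear X i -> V}).

Definition dsum_lift (t : dsum) : V :=
  \sum_(i <- undup (sval (cid (dsum_supp t)))) g i (t i).

(** Independence of the support chosen in [dsum_lift]: once the indices where [t] vanishes are
    dropped, two duplicate-free covers of the support are permutations of each other. *)
Lemma dsum_liftE (t : dsum) (s : seq I) : uniq s ->
  (forall i, i \notin s -> t i = 0) -> dsum_lift t = \sum_(i <- s) g i (t i).
Proof.
have aux (r : seq I) : \sum_(i <- r) g i (t i) =
    \sum_(i <- [seq i <- r | t i != 0]) g i (t i).
  rewrite big_filter [RHS]big_mkcond /=; apply: eq_bigr => i _.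
  by case: eqP => //= ->; rewrite raddf0.
move=> us ts; rewrite /dsum_lift; case: cid => r /= tr; rewrite aux [RHS]aux.
apply: perm_big; apply: uniq_perm; rewrite ?filter_uniq ?undup_uniq // => i.
rewrite !mem_filter mem_undup; have [//|ti /=] := eqVneq (t i) 0.
have [ir|/tr ti0] := boolP (i \in r); last by rewrite ti0 eqxx in ti.
by have [//|/ts ti0] := boolP (i \in s); rewrite ti0 eqxx in ti.
Qed.

Fact dsum_lift_zmod : zmod_morphism dsum_lift.
Proof.
move=> t u; have [[r tr] [s us]] := (dsum_supp t, dsum_supp u).
(* One list covering the supports of [t], [u] and [t - u] at once. *)
have nin i : i \notin undup (r ++ s) -> t i = 0 /\ u i = 0.
  by rewrite mem_undup mem_cat negb_or => /andP[/tr-> /us->].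
rewrite !(@dsum_liftE _ (undup (r ++ s))) ?undup_uniq //.
- by rewrite -sumrB; apply: eq_bigr => i _; rewrite -raddfB.
- by move=> i /nin[].
- by move=> i /nin[].
- by move=> i /nin[ti ui]; rewrite -[LHS]/(t i - u i) ti ui subr0.
Qed.
HB.instance Definition _ := GRing.isZmodMorphism.Build dsum V
  dsum_lift dsum_lift_zmod.

Fact dsum_lift_rscalable a : {morph dsum_lift : t / t :* a}.
Proof.
move=> t; have [r tr] := dsum_supp t.
rewrite !(@dsum_liftE _ (undup r)) ?undup_uniq //.
- by rewrite (big_morph _ (ractDl a) (ract0 (0 : V) a)); apply: eq_bigr => i _; rewrite -rlinearZ.
- by move=> i; rewrite mem_undup => /tr.
- by move=> i; rewrite mem_undup => /tr ti; rewrite -[LHS]/(t i :* a) ti (ract0 (0 : X i)).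
Qed.
HB.instance Definition _ := isRscalable.Build A dsum V
  dsum_lift dsum_lift_rscalable.

Lemma dsum_lift_inj i (x : X i) : dsum_lift (dsum_inj x) = g i x.
Proof.
rewrite (@dsum_liftE _ [:: i]) //; first by rewrite big_seq1 dsum_injE.
by move=> j; rewrite inE eq_sym => ij; rewrite dsum_inj_out.
Qed.
End Lift.
End DirectSumModule.

(** * Direct sums of comodules *)

Section ComoduleDirectSum.
Variables (A : pzRingType) (C : coring A) (I : choiceType) (X : I -> comodule C).

Local Notation S := (dsum (fun i => X i : rmodType A)).
Local Notation inj i := (@dsum_inj A I (fun j => X j : rmodType A) i).

Let coact_i i : {rlinear X i -> S ⊗ C} :=
  (inj i <⊗> 'id[C]) \o coaction (X i).

Definition dsum_coaction : {rlinear S -> S ⊗ C} := dsum_lift coact_i.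

Lemma dsum_coaction_inj i (x : X i) :
  dsum_coaction (inj i x) = (inj i <⊗> 'id[C]) (coaction (X i) x).
Proof. exact: (dsum_lift_inj coact_i). Qed.

(** On each summand, [E1] and [E2] move the injection outside and leave coassociativity of [X i]. *)
Fact dsum_coactionA : tensorA \o (dsum_coaction <⊗> 'id[C]) \o dsum_coaction
  =1 ('id[S] <⊗> comul C) \o dsum_coaction.
Proof.
apply: dsum_ext => [s t|s t|i x]; rewrite /comp ?rlinearD ?raddfD //.
rewrite !dsum_coaction_inj.
have E1 t : tensorA ((dsum_coaction <⊗> 'id[C]) ((inj i <⊗> 'id[C]) t)) =
    (inj i <⊗> 'id[C ⊗ C]) (tensorA ((coaction (X i) <⊗> 'id[C]) t)).
  elim/tensor_ind: t => [y c|s t IHs IHt]; last by rewrite !raddfD /= IHs IHt.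
  rewrite !tensor_map_pure dsum_coaction_inj.
  elim/tensor_ind: (coaction (X i) y) => [z d|s t IHs IHt].
    by rewrite tensor_map_pure !tensorA_pure tensor_map_pure.
  by rewrite !(raddfD, pureDl) /= IHs IHt.
have E2 t : ('id[S] <⊗> comul C) ((inj i <⊗> 'id[C]) t) =
    (inj i <⊗> 'id[C ⊗ C]) (('id[X i] <⊗> comul C) t).
  by rewrite !tensor_map_comp; apply: eq_tensor_map.
by rewrite E1 E2; have /= -> := coactionA x.
Qed.

Fact dsum_coaction_counit :
  tensorR1 \o ('id[S] <⊗> counit C) \o dsum_coaction =1 id.
Proof.
apply: dsum_ext => [s t|s t|i x]; rewrite /comp ?rlinearD ?raddfD //.
rewrite dsum_coaction_inj -[in RHS](coaction_counit x) /=.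
elim/tensor_ind: (coaction (X i) x) => [y c|s t IHs IHt].
  by rewrite !tensor_map_pure !tensorR1_pure rlinearZ.
by rewrite !raddfD /= IHs IHt.
Qed.

Definition dsum_comodule : comodule C :=
  Comodule dsum_coactionA dsum_coaction_counit.

Fact dsum_inj_colinear i : colinear (inj i : {rlinear X i -> dsum_comodule}).
Proof. by move=> x; exact: dsum_coaction_inj. Qed.

Definition dsum_inj_hom i : comodule_hom (X i) dsum_comodule :=
  ComoduleHom (@dsum_inj_colinear i).

Fact dsum_lift_colinear (Z : comodule C) (g : forall i, comodule_hom (X i) Z) :
  colinear (dsum_lift (fun i => g i : {rlinear X i -> Z}) : {rlinear dsum_comodule -> Z}).
Proof.
set u : {rlinear _ -> Z} := dsum_lift _.
have uE i (x : X i) : u (inj i x) = g i x by exact: dsum_lift_inj.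
apply: dsum_ext => [s t|s t|i x]; rewrite /comp ?rlinearD ?raddfD //.
have -> : coaction dsum_comodule (inj i x) = (inj i <⊗> 'id[C]) (coaction (X i) x).
  exact: dsum_coaction_inj.
rewrite uE tensor_map_comp; have /= -> := comodule_homP (g i) x.
by apply: eq_tensor_map => // y /=; rewrite -uE.
Qed.

Lemma dsum_comodule_direct_sum :
  is_direct_sum (K := comodule_category C) (S := dsum_comodule) dsum_inj_hom.
Proof.
move=> Z g; exists (ComoduleHom (@dsum_lift_colinear Z g)); split.
  by move=> i; apply: comodule_hom_eq => x; apply: dsum_lift_inj.
move=> u uE; apply: comodule_hom_eq => /=; apply: dsum_ext => [s t|s t|i x].
- exact: rlinearD.
- exact: rlinearD.
- by rewrite dsum_lift_inj -uE.
Qed.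
End ComoduleDirectSum.

Lemma comodule_direct_sums (A : pzRingType) (C : coring A) :
  has_direct_sums (comodule_category C).
Proof.
(* [{classic I}] gives an arbitrary index type the choice structure that [dsum] asks for. *)
move=> I X; exists (dsum_comodule (I := {classic I}) X).
exists (dsum_inj_hom (I := {classic I}) X).
exact (@dsum_comodule_direct_sum A C {classic I} X).
Qed.

(** * Cokernels of modules *)

Section CokernelModule.
Local Open Scope quotient_scope.
Variables (A : pzRingType) (X Y : rmodType A) (f : {rlinear X -> Y}).

Definition image_pred : {pred Y} := fun y => `[< exists x, y = f x >].

Fact image_pred_zmod_closed : zmod_closed image_pred.
Proof.
split=> [|y z /asboolP[x ->] /asboolP[x' ->]]; apply/asboolP.
  by exists 0; rewrite raddf0.
by exists (x - x'); rewrite raddfB.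
Qed.
HB.instance Definition _ :=
  GRing.isZmodClosed.Build Y image_pred image_pred_zmod_closed.

Definition coker : Type := Quotient.quot image_pred.
HB.instance Definition _ := GRing.Zmodule.on coker.

Definition coker_pi (y : Y) : coker := \pi_coker y.

Lemma coker_pi_eq (y z : Y) : coker_pi y = coker_pi z <-> exists x, y - z = f x.
Proof.
rewrite /coker_pi; split=> [/eqP|[x yz]].
  by rewrite -(@Quotient.idealrBE _ image_pred) => /asboolP.
by apply/eqP; rewrite -(@Quotient.idealrBE _ image_pred); apply/asboolP; exists x.
Qed.

Lemma coker_pi_onto (t : coker) : exists y, t = coker_pi y.
Proof. by exists (repr t); rewrite /coker_pi reprK. Qed.

Fact coker_pi_zmod : zmod_morphism coker_pi.
Proof. by move=> y z; rewrite /coker_pi raddfB. Qed.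
HB.instance Definition _ := GRing.isZmodMorphism.Build Y coker coker_pi coker_pi_zmod.

Definition coker_act (t : coker) (a : A) : coker := coker_pi (repr t :* a).

(** Two representatives differ by some [f x], hence by [f (x :* a)] after acting with [a]; so the
    action through [repr] is well defined. *)
Fact coker_act_pi y a : coker_act (coker_pi y) a = coker_pi (y :* a).
Proof.
have /coker_pi_eq[x xE] : coker_pi (repr (coker_pi y)) = coker_pi y.
  by rewrite /coker_pi reprK.
apply/coker_pi_eq; exists (x :* a).
by rewrite rlinearZ -xE ractDl (ractN a y).
Qed.

Fact coker_actA t a b : coker_act (coker_act t a) b = coker_act t (a * b).
Proof. by have [y ->] := coker_pi_onto t; rewrite !coker_act_pi ractA. Qed.
Fact coker_act1 t : coker_act t 1 = t.
Proof. by have [y ->] := coker_pi_onto t; rewrite !coker_act_pi ractr1. Qed.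
Fact coker_actDl a : {morph coker_act^~ a : s t / s + t}.
Proof.
move=> s t; have [[y ->] [z ->]] := (coker_pi_onto s, coker_pi_onto t).
by rewrite -raddfD !coker_act_pi ractDl raddfD.
Qed.
Fact coker_actDr t : {morph coker_act t : a b / a + b}.
Proof.
by move=> a b; have [y ->] := coker_pi_onto t; rewrite !coker_act_pi ractDr raddfD.
Qed.
HB.instance Definition _ := Zmodule_isRmodule.Build A coker
  coker_actA coker_act1 coker_actDl coker_actDr.

Fact coker_pi_rscalable a : {morph coker_pi : y / y :* a}.
Proof. by move=> y; rewrite -coker_act_pi. Qed.
HB.instance Definition _ := isRscalable.Build A Y coker coker_pi coker_pi_rscalable.

Lemma coker_pi_im x : coker_pi (f x) = 0.
Proof. by rewrite -(raddf0 coker_pi); apply/coker_pi_eq; exists x; rewrite subr0. Qed.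

Lemma coker_pi_eq0 y : coker_pi y = 0 -> exists x, y = f x.
Proof. by rewrite -(raddf0 coker_pi) => /coker_pi_eq[x]; rewrite subr0; exists x. Qed.
End CokernelModule.

(** * Right exact sequences and their tensor products *)

Section Exactness.
Variables (A : pzRingType) (X Y Q : rmodType A).
Variables (f : {rlinear X -> Y}) (q : {rlinear Y -> Q}).

(** Elementwise exactness of [X -> Y -> Q -> 0]. It mentions modules only, which makes it the form
    of being a cokernel that passes through [- ⊗ M]. *)
Record right_exact : Prop := RightExact {
  right_exact0 : forall x, q (f x) = 0;
  right_exact_onto : forall z, exists y, z = q y;
  right_exact_ker : forall y, q y = 0 -> exists x, y = f x
}.

Hypothesis fq : right_exact.

Lemma right_exact_factor (V : rmodType A) (g : {rlinear Y -> V}) :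
  (forall x, g (f x) = 0) -> exists u : {rlinear Q -> V}, forall y, u (q y) = g y.
Proof.
(* [u] evaluates [g] at a chosen preimage; two preimages differ by some [f x], which [g] kills. *)
move=> gf0; pose u z := g (sval (cid (right_exact_onto fq z))).
have uq y : u (q y) = g y.
  rewrite /u; case: cid => y' /= qy'; apply/eqP; rewrite -subr_eq0 -rlinearB.
  have [|x ->] := @right_exact_ker fq (y' - y); last exact/eqP/gf0.
  by rewrite rlinearB -qy' subrr.
have uB : zmod_morphism u.
  move=> z z'; have [[y ->] [y' ->]] := (right_exact_onto fq z, right_exact_onto fq z').
  by rewrite -rlinearB !uq rlinearB.
have uZ a : {morph u : z / z :* a}.
  by move=> z; have [y ->] := right_exact_onto fq z; rewrite -rlinearZ !uq rlinearZ.
pose U : {rlinear Q -> V} := HB.pack u (GRing.isZmodMorphism.Build _ _ _ uB)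
  (isRscalable.Build _ _ _ _ uZ).
by exists U.
Qed.

Lemma right_exact_tensor_onto (M : lmodType A) (t : Q ⊗ M) :
  exists s : Y ⊗ M, t = (q <⊗> 'id[M]) s.
Proof.
elim/tensor_ind: t => [z m|_ _ [s ->] [s' ->]].
  by have [y ->] := right_exact_onto fq z; exists (y ⊗ m); rewrite tensor_map_pure.
by exists (s + s'); rewrite raddfD.
Qed.

(** Preimages are chosen in the first variable only: [g (y ⊗ m)] depends on [q y] alone because [g]
    kills [f x ⊗ m], and the resulting function is balanced. Values lie in an abelian group since
    [M] carries only a left action here. *)
Lemma right_exact_tensor_factor (M : lmodType A) (V : zmodType)
    (g : {additive Y ⊗ M -> V}) :
  (forall s, g ((f <⊗> 'id[M]) s) = 0) ->
  exists2 u : Q ⊗ M -> V, zmod_morphism u & forall s, u ((q <⊗> 'id[M]) s) = g s.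
Proof.
move=> gf0; pose h z m := g (sval (cid (right_exact_onto fq z)) ⊗ m).
have hq y m : h (q y) m = g (y ⊗ m).
  rewrite /h; case: cid => y' /= qy'; apply/eqP; rewrite -subr_eq0 -raddfB -pureNl -pureDl.
  have [|x ->] := @right_exact_ker fq (y' - y); first by rewrite rlinearB -qy' subrr.
  by have := gf0 (x ⊗ m); rewrite tensor_map_pure => ->.
have hb : balanced h.
  split=> [z z' m|z m m'|z a m].
  - have [[y ->] [y' ->]] := (right_exact_onto fq z, right_exact_onto fq z').
    by rewrite -raddfD !hq pureDl raddfD.
  - by have [y ->] := right_exact_onto fq z; rewrite !hq pureDr raddfD.
  - by have [y ->] := right_exact_onto fq z; rewrite -rlinearZ !hq pureA.
exists (tensor_lift h); first exact: tensor_lift_zmod.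
elim/tensor_ind => [y m|s s' IHs IHs'].
  by rewrite tensor_map_pure tensor_lift_pure // hq.
by rewrite !raddfD /= tensor_liftD // IHs IHs'.
Qed.

(* Right exactness: the projection onto [coker (f ⊗ M)] factors through [q ⊗ M]. *)
Lemma right_exact_tensor (B : pzRingType) (M : bimodType A B) (t : Y ⊗ M) :
  (q <⊗> 'id[M]) t = 0 -> exists s, t = (f <⊗> 'id[M] : {rlinear X ⊗ M -> Y ⊗ M}) s.
Proof.
have [|u uB uE] := @right_exact_tensor_factor M _
  (@coker_pi B _ _ (f <⊗> 'id[M] : {rlinear X ⊗ M -> Y ⊗ M})).
  by move=> s; exact: (coker_pi_im (f <⊗> 'id[M] : {rlinear X ⊗ M -> Y ⊗ M})).
move=> qt; apply: coker_pi_eq0; rewrite -uE qt.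
by have := uB 0 0; rewrite !subrr.
Qed.
End Exactness.

Lemma tensor_right_exact (A B : pzRingType) (X Y Q : rmodType A) (M : bimodType A B)
    (f : {rlinear X -> Y}) (q : {rlinear Y -> Q}) :
  right_exact f q ->
  right_exact (f <⊗> 'id[M] : {rlinear X ⊗ M -> Y ⊗ M})
              (q <⊗> 'id[M] : {rlinear Y ⊗ M -> Q ⊗ M}).
Proof.
move=> fq; split=> [s|t|t]; last exact: (right_exact_tensor fq).
- elim/tensor_ind: s => [x m|s s' IHs IHs'].
    rewrite /= !tensor_map_pure (right_exact0 fq) -[0 in LHS](subrr 0) pureDl pureNl.
    by rewrite subrr.
  by rewrite !rlinearD IHs IHs' addr0.
- exact: (right_exact_tensor_onto fq).
Qed.

(** * Cokernels of comodules *)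

Section ComoduleCokernel.
Variables (A : pzRingType) (C : coring A) (X Y : comodule C) (f : comodule_hom X Y).

Local Notation Q := (coker f).
Local Notation q := (@coker_pi A X Y f).

Lemma coker_right_exact : right_exact f (q : {rlinear Y -> Q}).
Proof.
split; [exact: coker_pi_im | exact: coker_pi_onto | exact: coker_pi_eq0].
Qed.

(** [(q ⊗ C) \o coaction Y] vanishes on the image of [f]: colinearity of [f] rewrites it as
    [(q ⊗ C) \o (f ⊗ C)] after [coaction X], and [q \o f = 0]. *)
Let coker_coaction_ex : exists r : {rlinear Q -> Q ⊗ C},
  forall y, r (q y) = (q <⊗> 'id[C]) (coaction Y y).
Proof.
pose g : {rlinear Y -> Q ⊗ C} := (q <⊗> 'id[C]) \o coaction Y.
have [|r rE] := right_exact_factor coker_right_exact (g := g); last by exists r.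
move=> x; rewrite /g /=; have /= -> := comodule_homP f x.
exact: (right_exact0 (tensor_right_exact C coker_right_exact)).
Qed.

Definition coker_coaction : {rlinear Q -> Q ⊗ C} := sval (cid coker_coaction_ex).

Lemma coker_coaction_pi y : coker_coaction (q y) = (q <⊗> 'id[C]) (coaction Y y).
Proof. by rewrite /coker_coaction; case: cid. Qed.

Fact coker_coactionA : tensorA \o (coker_coaction <⊗> 'id[C]) \o coker_coaction
  =1 ('id[Q] <⊗> comul C) \o coker_coaction.
Proof.
move=> t; have [y ->] := coker_pi_onto t; rewrite /comp !coker_coaction_pi.
have E1 s : tensorA ((coker_coaction <⊗> 'id[C]) ((q <⊗> 'id[C]) s)) =
    (q <⊗> 'id[C ⊗ C]) (tensorA ((coaction Y <⊗> 'id[C]) s)).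
  elim/tensor_ind: s => [z c|s s' IHs IHs']; last by rewrite !raddfD /= IHs IHs'.
  rewrite !tensor_map_pure coker_coaction_pi.
  elim/tensor_ind: (coaction Y z) => [w d|s s' IHs IHs'].
    by rewrite tensor_map_pure !tensorA_pure tensor_map_pure.
  by rewrite !(raddfD, pureDl) /= IHs IHs'.
have E2 s : ('id[Q] <⊗> comul C) ((q <⊗> 'id[C]) s) =
    (q <⊗> 'id[C ⊗ C]) (('id[Y] <⊗> comul C) s).
  by rewrite !tensor_map_comp; apply: eq_tensor_map.
by rewrite E1 E2; have /= -> := coactionA y.
Qed.

Fact coker_coaction_counit :
  tensorR1 \o ('id[Q] <⊗> counit C) \o coker_coaction =1 id.
Proof.
move=> t; have [y ->] := coker_pi_onto t; rewrite /comp coker_coaction_pi.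
rewrite -[in RHS](coaction_counit y) /=.
elim/tensor_ind: (coaction Y y) => [z c|s s' IHs IHs'].
  by rewrite !tensor_map_pure !tensorR1_pure rlinearZ.
by rewrite !raddfD /= IHs IHs'.
Qed.

Definition coker_comodule : comodule C :=
  Comodule coker_coactionA coker_coaction_counit.

Fact coker_pi_colinear : colinear (q : {rlinear Y -> coker_comodule}).
Proof. by move=> y; exact: coker_coaction_pi. Qed.

Definition coker_pi_hom : comodule_hom Y coker_comodule := ComoduleHom coker_pi_colinear.
End ComoduleCokernel.

Section ComoduleCokernels.
Variables (A : pzRingType) (C : coring A).
Local Notation K := (comodule_category C).

(** The module factorization [u] is automatically colinear: since [q] is onto, this is checked on
    [q y], where it follows from colinearity of [g] and [q]. *)
Lemma right_exact_is_cokernel (X Y Q : comodule C) (f : comodule_hom X Y)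
    (q : comodule_hom Y Q) :
  right_exact f q -> is_cokernel (K := K) f q.
Proof.
move=> fq; split=> [|Z g gf0].
  by apply: comodule_hom_eq => x; exact: (right_exact0 fq).
have [|u uq] := right_exact_factor fq (g := g).
  by move=> x; have /(congr1 (fun h : comodule_hom X Z => h x)) := gf0.
have uC : colinear u.
  move=> z; have [y ->] := right_exact_onto fq z; rewrite /comp uq.
  have /= -> := comodule_homP g y; have /= -> := comodule_homP q y.
  by rewrite tensor_map_comp; apply: eq_tensor_map => // y' /=; rewrite uq.
exists (ComoduleHom uC); split; first by apply: comodule_hom_eq => y; exact: uq.
move=> v vq; apply: comodule_hom_eq => z /=.
by have [y ->] := right_exact_onto fq z; rewrite uq -vq.
Qed.

Lemma comodule_cokernels : has_cokernels K.
Proof.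
move=> X Y f; exists (coker_comodule f), (coker_pi_hom f).
exact/right_exact_is_cokernel/coker_right_exact.
Qed.

(* A cokernel agrees up to isomorphism with the one computed in modules. *)
Lemma is_cokernel_right_exact (X Y Q : comodule C) (f : comodule_hom X Y)
    (q : comodule_hom Y Q) :
  is_cokernel (K := K) f q -> right_exact f q.
Proof.
move=> [qf0 qU]; have := @right_exact_is_cokernel _ _ _ f (coker_pi_hom f) (coker_right_exact f).
move=> [pf0 pU]; have [u [up _]] := qU _ _ pf0; have [v [vp _]] := pU _ _ qf0.
have [w [_ wU]] := qU _ _ qf0.
(* Both maps agree after [q], so uniqueness identifies them. Surjectivity of [q] follows: if
   [u z = coker_pi y], then [z = v (u z) = q y]. *)
have vu : v ∘ u = idm (Q : K).
  rewrite -(wU (v ∘ u)); last by rewrite -compA up.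
  by apply: wU; rewrite comp1m.
split=> [x|z|y qy].
- by have /(congr1 (fun h : comodule_hom X Q => h x)) := qf0.
- have [y uz] := coker_pi_onto ((u : comodule_hom _ _) z); exists y.
  have /(congr1 (fun h : comodule_hom Q Q => h z)) /= <- := vu.
  by rewrite uz -vp.
(* The class of [y] is [u (q y) = u 0 = 0], so [y] lies in the image of [f]. *)
- apply: coker_pi_eq0.
  have /(congr1 (fun h : comodule_hom Y _ => h y)) /= <- := up.
  by rewrite qy raddf0.
Qed.
End ComoduleCokernels.

(** * Additivity and cokernel preservation of push-out functors *)

Section PushoutExact.
Variables (A B : pzRingType) (C : coring A) (D : coring B).
Variables (M : bimodType A B) (m : {bihom C ⊗ M -> M ⊗ D}).
Hypothesis m_counit :
  tensorR1 \o ('id[M] <⊗> counit D) \o m =1 tensorL1 \o (counit C <⊗> 'id[M]).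
Hypothesis m_comul :
  tensorA \o (m <⊗> 'id[D]) \o tensorAV \o ('id[C] <⊗> m) \o tensorA
    \o (comul C <⊗> 'id[M]) =1 ('id[M] <⊗> comul D) \o m.

Lemma pushout_functor_additive : is_additive_functor (pushout_functor m_counit m_comul).
Proof.
move=> X Y f g; apply: comodule_hom_eq => t /=.
exact: tensor_mapDl.
Qed.

Lemma pushout_functor_cokernels : preserves_cokernels (pushout_functor m_counit m_comul).
Proof.
move=> X Y Q f q /is_cokernel_right_exact fq.
exact/right_exact_is_cokernel/tensor_right_exact.
Qed.
End PushoutExact.

(** * The natural transformations and the wide Morita context *)

Section EtaTildeNatTrans.
Variables (A B : pzRingType) (C : coring A) (D : coring B).
Variable Gamma : one_cell D C.

Definition eta_tilde_hom (X : comodule C) :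
    comodule_hom (functor_N Gamma (functor_M Gamma X)) X :=
  ComoduleHom (@eta_tilde_colinear _ _ _ _ Gamma X).

Fact eta_tilde_hom_natural (X X' : comodule C) (f : comodule_hom X X') :
  comodule_comp (eta_tilde_hom X')
    (fmap (functor_comp (functor_N Gamma) (functor_M Gamma)) (f : hom (X : comodule_category C) X')) =
  comodule_comp f (eta_tilde_hom X).
Proof.
apply: comodule_hom_eq => t; exact: (eta_tilde_natural (comodule_homP f)).
Qed.

Definition eta_nat : nat_trans (functor_comp (functor_N Gamma) (functor_M Gamma))
    (functor_id (comodule_category C)) :=
  @NatTrans _ _ (functor_comp (functor_N Gamma) (functor_M Gamma))
    (functor_id (comodule_category C)) eta_tilde_hom eta_tilde_hom_natural.
End EtaTildeNatTrans.

Theorem proposition2p3 (A B : pzRingType) (C : coring A) (D : coring B)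
    (Gamma : one_cell D C) :
  [/\ forall X : comodule C,
        colinear (eta_tilde Gamma X : {rlinear functor_N Gamma (functor_M Gamma X) -> X}),
      forall Y : comodule D,
        colinear (rho_tilde Gamma Y : {rlinear functor_M Gamma (functor_N Gamma Y) -> Y})
    & exists (eta : nat_trans (functor_comp (functor_N Gamma) (functor_M Gamma))
                              (functor_id (comodule_category C)))
             (rho : nat_trans (functor_comp (functor_M Gamma) (functor_N Gamma))
                              (functor_id (comodule_category D))),
        [/\ forall X : comodule C, comodule_hom_fun (eta X) = eta_tilde Gamma X,
            forall Y : comodule D, comodule_hom_fun (rho Y) = rho_tilde Gamma Y
          & wide_right_Morita_context eta rho]].
Proof.
(* Swapping exchanges [M] with [N] and [eta] with [rho], so [rho_tilde Gamma] is by computation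
   [eta_tilde (one_cell_swap Gamma)], and likewise [functor_M Gamma] is [functor_N] of the swapped
   cell. *)
split; [exact: eta_tilde_colinear | exact: (@eta_tilde_colinear _ _ _ _ (one_cell_swap Gamma)) |].
exists (eta_nat Gamma), (eta_nat (one_cell_swap Gamma)); split=> //; split.
- exact/direct_sums_additive/comodule_direct_sums.
- exact: comodule_cokernels.
- exact: comodule_direct_sums.
- exact/direct_sums_additive/comodule_direct_sums.
- exact: comodule_cokernels.
- exact: comodule_direct_sums.
- exact: pushout_functor_additive.
- exact: pushout_functor_cokernels.
- exact: pushout_functor_additive.
- exact: pushout_functor_cokernels.
- by move=> Y; apply: comodule_hom_eq; exact: (@eta_tilde_pushout _ _ _ _ Gamma Y).
- by move=> X; apply: comodule_hom_eq; exact: (@eta_tilde_pushout _ _ _ _ (one_cell_swap Gamma) X).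
Qed.
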